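(* Consider the weak stochastic control problem and the policy improvement algorithm (PIA) described in the context. Assume: (1) there exists a non-empty subset $I^*$ of the set $I$ of improvable Markov policies such that $\pi_0\in I^*$ implies that, for each $n\in\mathbb{N}$, the Markov policy $\pi_n$ produced by the PIA started at $\pi_0$ is a continuous function $S\to A$ belonging to $I^*$; (2) for any Markov policy $\pi_0\in I^*$, with $(\pi_n)_{n\in\mathbb{N}}$ the sequence produced by the PIA started at $\pi_0$, for each $n\in\mathbb{N}$ and each $x\in D$ there is a random variable $Z_x$ with $Z_x\ge 0$ a.s. such that (where $X^{\pi_{n+1}}_0=x$ and $\tau$ is the first exit time of $X^{\pi_{n+1}}$ from $D$) $$V^{\pi_{n+1}}(X^{\pi_{n+1}}_{t\wedge\tau})-V^{\pi_n}(X^{\pi_{n+1}}_{t\wedge\tau})\longrightarrow Z_x\quad\text{in } L^1 \text{ as } t\uparrow\infty .$$ Let $\pi_0\in I^*$ and let $(\pi_n)_{n\in\mathbb{N}}$ be the sequence produced by the PIA started at $\pi_0$. Then $$V^{\pi_{n+1}}(x)\ge V^{\pi_n}(x)\qquad\text{for each } n\in\mathbb{N} \text{ and all } x\in S.$$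
   Context: Setting. $S$ is a topological space (state space), $A$ is a compact metric space (control set), and $D\subseteq S$ is a domain (open and connected subset) with $D=\bigcup_{n\ge1}K_n$, where $(K_n)$ is an increasing family of compact sets in $S$ with $K_n$ contained in the interior of $K_{n+1}$ for all $n$. The functions $f:S\times A\to\mathbb{R}_+$ and $g:S\to\mathbb{R}_+$ are continuous. For each $a\in A$, $X^a$ is a strong Markov process with state space $S$ and given (martingale) infinitesimal generator $\mathcal{L}^a$ with domain $\mathbf{D}^a$ (a set of real functions on $S$). There is a fixed nonempty subset $\mathbf{C}\subseteq\bigcap_{a\in A}\mathbf{D}^a$ such that $(x,a)\mapsto\mathcal{L}^a\phi(x)$ is jointly continuous on $D\times A$ for each $\phi\in\mathbf{C}$. Controls. A control process $\Pi$ is an $A$-valued $(\mathcal{F}_t)$-adapted process on some filtered probability space $(\Omega,(\mathcal{F}_t)_{t\ge0},\mathcal{F},\mathbb{P})$, which may depend on $\Pi$. For $x\in S$, $\mathcal{A}_x$ is the set of all control processes $\Pi$ for which there exists an $(\mathcal{F}_t)$-adapted right-continuous $S$-valued process $X^\Pi$ such that: (i) $X^\Pi_0=x$; (ii) the law of $(X^\Pi,\Pi)$ is unique; (iii) for each $\phi\in\mathbf{C}$, the process $\phi(X^\Pi_{t\wedge\tau})-\int_0^{t\wedge\tau}\mathcal{L}^{\Pi_s}\phi(X^\Pi_s)\,ds$, $t\ge0$, is a martingale, where the stopping time $\tau$ is the first exit time of $X^\Pi$ from $D$; (iv) with $J(x,\Pi):=\int_0^\tau f(X^\Pi_t,\Pi_t)\,dt+g(X^\Pi_\tau)1_{(\tau<\infty)}$,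 we have $\int_0^{t\wedge\tau}f(X^\Pi_s,\Pi_s)\,ds+g(X^\Pi_\tau)1_{(\tau<\infty)}\to J(x,\Pi)$ in $L^1$ as $t\to\infty$. Markov policies. A Markov policy is a function $\pi:S\to A$ such that for each $x\in D$ there exists an adapted process $X$ on a stochastic basis with: $X_0=x$; $\Pi:=\pi(X)$ (i.e. $\Pi_t:=\pi(X_t)$, $t\ge0$) is in $\mathcal{A}_x$; and $(X^\Pi,\Pi)$ and $(X,\pi(X))$ have the same law. Such an $X$ is denoted $X^\pi$. Payoffs. $V^\Pi(x):=\mathbb{E}[J(x,\Pi)]$ for $\Pi\in\mathcal{A}_x$, and $V^\pi(x):=\mathbb{E}[J(x,\pi(X^\pi))]$ for a Markov policy $\pi$. For $x\in S\setminus D$ one has $\tau=0$ and $V^\pi(x)=g(x)$ for every Markov policy $\pi$. Improvement and PIA. A Markov policy $\pi$ is improvable if $V^\pi\in\mathbf{C}$; $I$ denotes the set of improvable Markov policies. A Markov policy $\pi'$ is an improvement of $\pi\in I$ if for each $x\in D$ $$\mathcal{L}^{\pi'(x)}V^\pi(x)+f(x,\pi'(x))=\sup_{a\in A}\left[\mathcal{L}^aV^\pi(x)+f(x,a)\right].$$ The PIA started at $\pi_0$ produces a sequence $(\pi_n)_{n\in\mathbb{N}}$ in which $\pi_{n+1}$ is a (chosen) improvement of the improvable Markov policy $\pi_n$ for each $n$. Policies are indexed by $\mathbb{N}=\{0,1,2,\dots\}$.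
   Formalization: The formal theorem additionally assumes that, for each policy π in I*, the processes X^π started at the points of D form a Markov family up to the exit time from D; without this the selection of X^π may be non-Markov and the claim can fail. *)

(* Defs.v *)
(* R : realType is the field of real numbers and also serves as the time axis,
   only times t with 0 <= t being relevant. *)
From HB Require Import structures.
From mathcomp Require Import all_boot all_order all_algebra.
From mathcomp Require Import all_classical all_reals all_analysis.
From mathcomp Require Import measurable_realfun.

Set Implicit Arguments.
Unset Strict Implicit.
Unset Printing Implicit Defensive.

Import Order.TTheory GRing.Theory Num.Theory.
Import numFieldNormedType.Exports.

Local Open Scope classical_set_scope.
Local Open Scope ring_scope.

Record basis (R : realType) := Basis {
  basis_disp : measure_display ;
  sample :> measurableType basis_disp ;
  prob : probability sample R ;
  filt : R -> set (set sample) ;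
  filt_sigma : forall t, 0 <= t -> sigma_algebra setT (filt t) ;
  filt_sub : forall t, 0 <= t -> filt t `<=` measurable ;
  filt_mono : forall s t, 0 <= s -> s <= t -> filt s `<=` filt t }.

Section stochastic_processes.
Context {R : realType}.
Implicit Types B : basis R.

(* With respect to the Borel sigma-algebra of T. *)
Definition adapted B (T : topologicalType) (X : R -> B -> T) :=
  forall t, 0 <= t -> forall U, <<s @open T >> U -> filt t (X t @^-1` U).

Definition right_cont B (T : topologicalType) (X : R -> B -> T) :=
  forall w t, 0 <= t -> X s w @[s --> t^'+] --> X t w.

Definition stopping_time B (sigma : B -> \bar R) :=
  forall t, 0 <= t -> filt t [set w | (sigma w <= t%:E)%E].

Definition stopped_filt B (sigma : B -> \bar R) : set (set B) :=
  [set G | measurable G /\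
    forall t, 0 <= t -> filt t (G `&` [set w | (sigma w <= t%:E)%E])].

(* The last condition says that M s is a version of E[M t | F_s]. *)
Definition martingale B (M : R -> B -> R) :=
  [/\ adapted (M : R -> B -> R^o),
      forall t, 0 <= t -> (prob B).-integrable setT (fun w => (M t w)%:E) &
      forall s t, 0 <= s -> s <= t -> forall G, filt s G ->
        (\int[prob B]_(w in G) (M t w)%:E = \int[prob B]_(w in G) (M s w)%:E)%E].

Definition cvg_L1 B (Y : R -> B -> \bar R) (Z : B -> \bar R) :=
  [/\ forall t, 0 <= t -> (prob B).-integrable setT (Y t),
      (prob B).-integrable setT Z &
      (\int[prob B]_w `|Y t w - Z w|)%E @[t --> +oo%R] --> 0%E].

(* The product sigma-algebra on pairs of paths; the two components are tested
   separately, as the Borel sigma-algebra of T1 * T2 may be strictly larger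
   than the product of the Borel sigma-algebras. *)
Definition path_sigma_algebra (T1 T2 : topologicalType) :
    set (set (R -> T1 * T2)) :=
  <<s [set E | exists2 t : R, 0 <= t &
        (exists2 U, open U & E = [set z | U (z t).1]) \/
        (exists2 W, open W & E = [set z | W (z t).2])] >>.

(* The measurability premises hold automatically for processes; they only
   guard against evaluating the probability at a non-measurable set. *)
Definition same_law B (T1 T2 : topologicalType) (Z Z' : R -> B -> T1 * T2) :=
  forall E, path_sigma_algebra E ->
    let e := [set w | E (Z ^~ w)] in let e' := [set w | E (Z' ^~ w)] in
    measurable e -> measurable e' -> prob B e = prob B e'.

Record process (S : topologicalType) := Process {
  pbasis : basis R ;
  traj :> R -> pbasis -> S }.

Definition plaw S (Y : process S) := prob (pbasis Y).

End stochastic_processes.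

Section exit.
Context {R : realType} {S : topologicalType}.
Variable D : set S.
Implicit Types (t : R) (u : \bar R).

(* +oo when the path never leaves D *)
Definition exit_time (w : R -> S) : \bar R :=
  ereal_inf [set t%:E | t in [set t | 0 <= t /\ ~ D (w t)]].

Definition stop_at (w : R -> S) t : R := fine (mine (Num.max 0 t)%:E (exit_time w)).

Definition stopped (w : R -> S) : R -> S := fun t => w (stop_at w t).

(* The path of w after time t, stopped on leaving D. Here and in [stopped],
   negative times are sent to 0 so that no functional of the resulting path
   can see anything prior to its origin. *)
Definition future (w : R -> S) t : R -> S := fun s => stopped w (t + Num.max 0 s).

(* the interval [0, u /\ exit_time w[ *)
Definition before_exit (w : R -> S) u : set R :=
  [set s | 0 <= s /\ (s%:E < mine u (exit_time w))%E].

(* phi(X_{t/\tau}) - \int_0^{t/\tau} psi_s ds is a martingale, where tau is the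
   exit time from D; the first clause says that the integral exists. *)
Definition dynkin_martingale (B : basis R) (phi : S -> R) (psi : R -> B -> R)
    (X : R -> B -> S) :=
  {ae prob B, forall w, forall t, 0 <= t ->
     (@lebesgue_measure R).-integrable (before_exit (X ^~ w) t%:E)
       (fun s => (psi s w)%:E)} /\
  martingale (fun t w => phi (stopped (X ^~ w) t) -
    \int[@lebesgue_measure R]_(s in before_exit (X ^~ w) t%:E) psi s w).

(* The Markov property, at the time sigma and up to the exit from D, of the
   family Y, where Y x is the process started at x:
     E[Phi(future of Y x after sigma) | F_sigma] = E_{(Y x)_sigma}[Phi]
   on {sigma < tau}, for every nonnegative functional Phi of the stopped path
   for which both sides make sense. As the filtrations need not be complete,
   the right-hand side is only required to be measurable on the whole basis. *)
Definition markov_at (Y : S -> process S) (x : S)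
    (sigma : pbasis (Y x) -> \bar R) :=
  forall Phi : (R -> S) -> \bar R,
  (forall w, 0 <= Phi w)%E ->
  (forall y, D y ->
    (plaw (Y y)).-integrable setT (fun w => Phi (stopped (Y y ^~ w)))) ->
  let A := [set w | (sigma w < exit_time (Y x ^~ w))%E] in
  let lhs (w : pbasis (Y x)) : \bar R := Phi (future (Y x ^~ w) (fine (sigma w))) in
  let rhs (w : pbasis (Y x)) : \bar R := (\int[plaw (Y (Y x (fine (sigma w)) w))]_v
                  Phi (stopped (Y (Y x (fine (sigma w)) w) ^~ v)))%E in
  measurable_fun A lhs ->
  measurable_fun A rhs /\
  forall G, stopped_filt sigma G ->
    (\int[plaw (Y x)]_(w in G `&` A) lhs w =
     \int[plaw (Y x)]_(w in G `&` A) rhs w)%E.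

Definition markov_until_exit (Y : S -> process S) :=
  forall x, D x -> forall t, 0 <= t -> @markov_at Y x (fun=> t%:E).

End exit.

Definition strong_markov (R : realType) (S : topologicalType)
    (Y : S -> @process R S) :=
  forall x (sigma : pbasis (Y x) -> \bar R), (forall w, 0 <= sigma w)%E ->
    stopping_time sigma -> markov_at setT sigma.

(* Generators act on arbitrary functions S -> R; only the values on [gen_dom]
   are meaningful. *)
Record control_problem (R : realType) (S : topologicalType)
    (A : metricType R) := ControlProblem {
  dom : set S ;
  exhaustion : nat -> set S ;
  runc : S -> A -> R ;
  termc : S -> R ;
  free : A -> S -> @process R S ;
  gen : A -> (S -> R) -> S -> R ;
  gen_dom : A -> set (S -> R) ;
  core : set (S -> R) ;
  action_compact : compact [set: A] ;
  dom_open : open dom ;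
  dom_connected : connected dom ;
  dom_exhaustion : dom = \bigcup_n exhaustion n ;
  exhaustion_compact : forall n, compact (exhaustion n) ;
  exhaustion_nested : forall n, exhaustion n `<=` interior (exhaustion n.+1) ;
  runc_continuous : continuous (fun p : S * A => runc p.1 p.2) ;
  runc_ge0 : forall x a, 0 <= runc x a ;
  termc_continuous : continuous termc ;
  termc_ge0 : forall x, 0 <= termc x ;
  free_start : forall a x w, free a x 0 w = x ;
  free_adapted : forall a x, adapted (free a x) ;
  free_strong_markov : forall a, strong_markov (free a) ;
  free_generator : forall a phi x, gen_dom a phi ->
    dynkin_martingale setT phi (fun s w => gen a phi (free a x s w)) (free a x) ;
  core_nonempty : core !=set0 ;
  core_sub : core `<=` \bigcap_(a in [set: A]) gen_dom a ;
  gen_continuous : forall phi, core phi ->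
    {within dom `*` [set: A], continuous (fun p : S * A => gen p.2 phi p.1)} }.

Section control.
Context {R : realType} {S : topologicalType} {A : metricType R}.
Variable Q : control_problem S A.

Let D : set S := dom Q.
Let f : S -> A -> R := runc Q.
Let g : S -> R := termc Q.
Let L : A -> (S -> R) -> S -> R := gen Q.

(* g(w_tau) 1_(tau < oo) *)
Definition terminal_cost (w : R -> S) : \bar R :=
  if exit_time D w is r%:E then (g (w r))%:E else 0%E.

(* With u = +oo this is the total payoff J. *)
Definition payoff_upto (w : R -> S) (p : R -> A) (u : \bar R) : \bar R :=
  (\int[@lebesgue_measure R]_(s in before_exit D w u) (f (w s) (p s))%:E
   + terminal_cost w)%E.

Definition payoff (w : R -> S) (p : R -> A) : \bar R := payoff_upto w p +oo%E.

Definition stopped_pair (B : basis R) (X : R -> B -> S) (Pi : R -> B -> A)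
    (t : R) (w : B) : S * A :=
  (stopped D (X ^~ w) t, Pi (stop_at D (X ^~ w) t) w).

Definition controlled_process (B : basis R) (x : S) (Pi : R -> B -> A)
    (X : R -> B -> S) :=
  [/\ adapted X /\ right_cont X,
      forall w, X 0 w = x,
      stopping_time (fun w => exit_time D (X ^~ w)),
      forall phi, core Q phi ->
        dynkin_martingale D phi (fun s w => L (Pi s w) phi (X s w)) X &
      {ae prob B, forall w, measurable_fun (before_exit D (X ^~ w) +oo%E)
                                           (fun s => f (X s w) (Pi s w))} /\
      cvg_L1 (fun t w => payoff_upto (X ^~ w) (Pi ^~ w) t%:E)
             (fun w => payoff (X ^~ w) (Pi ^~ w))].

(* Uniqueness in law is understood up to the exit time: nothing constrains a
   controlled process after it has left D. *)
Definition is_controlled (B : basis R) (x : S) (Pi : R -> B -> A)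
    (X : R -> B -> S) :=
  controlled_process x Pi X /\
  forall X' : R -> B -> S, controlled_process x Pi X' ->
    same_law (stopped_pair X' Pi) (stopped_pair X Pi).

Definition admissible (B : basis R) (x : S) (Pi : R -> B -> A) :=
  adapted Pi /\ exists X : R -> B -> S, is_controlled x Pi X.

Definition feedback (pi : S -> A) (B : basis R) (X : R -> B -> S) :
    R -> B -> A := fun t w => pi (X t w).

(* Y is a process X^pi started at x: Pi = pi(Y) is an admissible control, and Y
   is itself the process X^Pi controlled by Pi. *)
Definition policy_process (pi : S -> A) (x : S) (Y : @process R S) :=
  admissible x (feedback pi Y) /\ is_controlled x (feedback pi Y) Y.

Definition markov_policy (pi : S -> A) :=
  forall x, D x -> exists Y : process S, policy_process pi x Y.

(* [Xpol pi x] is the chosen process X^pi started at x. *)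
Section policies.
Variable Xpol : (S -> A) -> S -> @process R S.

Definition value (pi : S -> A) (x : S) : R :=
  if x \in D then
    fine (\int[plaw (Xpol pi x)]_w
            payoff (Xpol pi x ^~ w) (feedback pi (Xpol pi x) ^~ w))%E
  else g x.

Definition improvable (pi : S -> A) := markov_policy pi /\ core Q (value pi).

Definition improvement (pi pi' : S -> A) :=
  markov_policy pi' /\
  forall x, D x ->
    L (pi' x) (value pi) x + f x (pi' x) =
    sup (range (fun a => L a (value pi) x + f x a)).

Definition pia_run (pi0 : S -> A) (pi_ : nat -> S -> A) :=
  pi_ 0%N = pi0 /\
  forall n, improvable (pi_ n) /\ improvement (pi_ n) (pi_ n.+1).

End policies.
End control.

(* Main.v *)
(* Write L^a for the generators, f for the running cost, V_n for the value of pi_n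
   and tau for the exit time of the path X under consideration. By the Markov
   property, V_n(X_{min(t, tau)}) + \int_0^{min(t, tau)} f(X, pi_n(X)) ds has the same
   expectation as the total payoff on every event of F_t. Subtracting the Dynkin
   martingale of V_n, the process N_t = \int_0^{min(t, tau)} (L^pi_n V_n + f)(X_s) ds is a
   continuous martingale of finite variation, and so its rate at time 0 cannot be
   negative: L^pi_n V_n + f >= 0 on D. Hence L^pi_{n+1} V_n + f >= 0 on D, as pi_{n+1}
   maximizes the left-hand side pointwise. Along X^pi_{n+1} this turns the Dynkin
   martingale of V_n into E[(V_{n+1} - V_n)(X_{min(t, tau)})] <= V_{n+1}(x) - V_n(x), and
   the left-hand side tends to E[Z_x] >= 0. *)
From HB Require Import structures.
Require Import Defs.
From mathcomp Require Import all_boot all_order all_algebra.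
From mathcomp Require Import all_classical all_reals all_analysis.
From mathcomp Require Import measurable_realfun.
From mathcomp Require Import ring lra.

Set Implicit Arguments.
Unset Strict Implicit.
Unset Printing Implicit Defensive.

Import Order.TTheory GRing.Theory Num.Theory.
Import numFieldNormedType.Exports.

Local Open Scope classical_set_scope.
Local Open Scope ring_scope.

(** The integrands are known to be continuous only on D, and a path is unconstrained after its exit.
    Integrals up to min(t, tau) are therefore rewritten over the fixed interval [0, t[, with an
    integrand that vanishes from the exit on. As the policies are continuous, this integrand is
    right-continuous along every path. This makes N_t measurable for F_t without completing the
    filtration, and gives a meaning to the rate at time 0. The sum of V_n(X) and the running cost is
    not shown to be adapted: only its integrals over events of F_t are computed, and they pass to
    N_t, which agrees almost surely with the difference and is adapted by construction. Costs are
    nonnegative, so the Markov identity can be split at time t before any integrability is known;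
    the integrability of both terms then follows from that of the total payoff. The equation L^pi_n
    V_n + f = 0 is not proved: its inequality >= 0 suffices, and a one-sided stopping argument gives
    it. *)

(** * Joint measurability and time integrals of right-continuous processes *)

Section right_continuous_processes.
Context d (T : measurableType d) (R : realType).

(* [p.2] is approximated from the right by the points of the grid of mesh t/(n+1). *)
Lemma right_cont_measurable_prod (k : R -> T -> R) (t : R) :
  (forall s, 0 <= s <= t -> measurable_fun setT (k s)) ->
  (forall w s, 0 <= s < t -> k u w @[u --> s^'+] --> k s w) ->
  measurable_fun (setT `*` `[0, t[) (fun p : T * R => k p.2 p.1).
Proof.
move=> mk ck.
have [t0|t0] := leP t 0.
  by rewrite set_itv_ge ?setX0 -?ltNge ?bnd_simp -?leNgt//; exact: measurable_fun_set0.
pose idx n (s : R) := Num.trunc (s * n.+1%:R / t).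
(* Strictly above [s], so that right continuity applies even when [s] is a grid point, and at most
   [t] for [s < t], so that no measurability beyond time [t] is used. *)
pose up n s := t * (idx n s).+1%:R / n.+1%:R.
have n1 n : 0 < n.+1%:R :> R by rewrite ltr0n.
have idxE n (s : R) : 0 <= s -> (idx n s)%:R <= s * n.+1%:R / t < (idx n s).+1%:R.
  by move=> s0; apply: truncn_itv; apply: divr_ge0; [exact: mulr_ge0|exact: ltW].
apply: (measurable_fun_cvg (h := fun n (p : T * R) => k (up n p.2) p.1)); last first.
  move=> [w s] [_] /=; rewrite in_itv/= => /andP[s0 st].
  have /cvg_at_rightP cks : k u w @[u --> s^'+] --> k s w by apply: ck; rewrite s0.
  apply: cks; split.
    move=> n; have /andP[_] := idxE n s s0.
    by rewrite ltr_pdivrMr// /up ltr_pdivlMr// [t * _]mulrC.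
  apply: (@squeeze_cvgr _ _ _ _ (cst s) (fun n => s + t * n.+1%:R^-1)).
  - near=> n; have /andP[h1 h2] := idxE n s s0; apply/andP; split.
      by move: h2; rewrite ltr_pdivrMr// /up ler_pdivlMr// [t * _]mulrC => /ltW.
    rewrite /up ler_pdivrMr// mulrDl -mulrA mulVf ?gt_eqF// mulr1.
    by rewrite -natr1 mulrDr mulr1 lerD2r mulrC -ler_pdivlMr.
  - exact: cvg_cst.
  - rewrite -[X in _ --> X]addr0; apply: cvgD; first exact: cvg_cst.
    by rewrite -[X in _ --> X](mulr0 t); apply: cvgMr; exact: cvg_harmonic.
move=> n.
pose E i : set (T * R) := setT `*` (`[0, t[ `&` `[t * i%:R / n.+1%:R, t * i.+1%:R / n.+1%:R[).
have DE : setT `*` `[0, t[ = \bigcup_i E i.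
  apply/seteqP; split => [[w s] [_ st]|[w s] [i _ [_ []]]//].
  exists (idx n s) => //; split => //; split => //=.
  move: st; rewrite /= !in_itv/= => /andP[s0 st].
  have /andP[h1 h2] := idxE n s s0.
  rewrite ler_pdivrMr// mulrC -ler_pdivlMr// h1/=.
  by rewrite ltr_pdivlMr// [t * _]mulrC -ltr_pdivrMr.
have mE i : measurable (E i).
  by apply: measurableX => //; apply: measurableI; exact: measurable_itv.
rewrite DE; apply/(measurable_fun_bigcup _ mE) => i.
have [ni|ni] := ltnP n i.
  rewrite (_ : E i = set0); first exact: measurable_fun_set0.
  apply/seteqP; split => [[w s] [_ []]|//] /=.
  rewrite !in_itv/= => /andP[s0 st] /andP[h _]; move: st; rewrite ltNge => /negP; apply.
  by apply: le_trans h; rewrite ler_pdivlMr// ler_pM2l// ler_nat.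
apply: (eq_measurable_fun (fun p : T * R => k (t * i.+1%:R / n.+1%:R) p.1)).
  move=> [w s] /[!inE] -[_ []] /=; rewrite !in_itv/= => /andP[s0 st] /andP[h1 h2].
  rewrite /up /idx; congr (k (t * _.+1%:R / _) w); apply/esym/truncn_def.
  rewrite ler_pdivlMr// mulrC -ler_pdivrMr// h1/=.
  by rewrite ltr_pdivrMr// [X in _ < X]mulrC -ltr_pdivlMr.
apply: measurable_funTS; apply: (measurableT_comp _ measurable_fst).
apply: mk; apply/andP; split; first by rewrite divr_ge0// mulr_ge0// ltW.
by rewrite ler_pdivrMr// ler_pM2l// ler_nat.
Unshelve. all: by end_near. Qed.

(** No integrability is assumed: Tonelli applies to the positive and negative parts, and the
    integral is by definition their difference, even when both are infinite. *)
Lemma measurable_fun_integral_section (k : R -> T -> R) (E : set R) :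
  measurable E -> measurable_fun (setT `*` E) (fun p : T * R => k p.2 p.1) ->
  measurable_fun setT
    (fun w => \int[@lebesgue_measure R]_(s in E) (k s w)%:E)%E.
Proof.
move=> mE mk.
pose F (p : T * R) : \bar R := (((fun p : T * R => k p.2 p.1) \_ (setT `*` E)) p)%:E.
have mF : measurable_fun setT F.
  apply/measurable_EFinP/(measurable_restrictT _ _).1 => //.
  exact: measurableX.
have FE : (fun w => \int[@lebesgue_measure R]_(s in E) (k s w)%:E)%E =
          (fun w => \int[@lebesgue_measure R]_s F (w, s))%E.
  apply/funext => w; rewrite integral_mkcond; apply: eq_integral => s _.
  rewrite /F !patchE; have [?|?] := pselect (E s).
    by rewrite !mem_set.
  by rewrite !memNset// => -[].
rewrite FE.
under eq_fun do rewrite integralE.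
have tonelli (G : T * measurableTypeR R -> \bar R) : measurable_fun setT G ->
    (forall p, (0 <= G p)%E) ->
    measurable_fun setT (fun w => \int[@lebesgue_measure R]_s G (w, s))%E.
  by move=> mG G0; exact: (measurable_fun_fubini_tonelli_F G mG G0).
have Hp : measurable_fun setT F^\+%E by exact: measurable_funepos.
have Hn : measurable_fun setT F^\-%E by exact: measurable_funeneg.
move: (tonelli _ Hp (@funepos_ge0 _ _ _)) (tonelli _ Hn (@funeneg_ge0 _ _ _)).
by rewrite !unlock; exact: emeasurable_funB.
Qed.

(** Plays the role of progressive measurability: with [T := past B t], the integral up to [t] of an
    adapted right-continuous integrand is [filt t]-measurable. *)
Lemma right_cont_measurable_integral (k : R -> T -> R) (t : R) :
  (forall s, 0 <= s <= t -> measurable_fun setT (k s)) ->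
  (forall w s, 0 <= s < t -> k u w @[u --> s^'+] --> k s w) ->
  measurable_fun setT
    (fun w => \int[@lebesgue_measure R]_(s in `[0%R, t[) (k s w)%:E)%E.
Proof.
move=> mk ck; apply: measurable_fun_integral_section; first exact: measurable_itv.
exact: right_cont_measurable_prod.
Qed.

Lemma right_cont_measurable_integral_pinfty (k : R -> T -> R) :
  (forall s, 0 <= s -> measurable_fun setT (k s)) ->
  (forall w s, 0 <= s -> k u w @[u --> s^'+] --> k s w) ->
  measurable_fun setT
    (fun w => \int[@lebesgue_measure R]_(s in `[0%R, +oo[) (k s w)%:E)%E.
Proof.
move=> mk ck; apply: measurable_fun_integral_section; first exact: measurable_itv.
rewrite (itv_bndy_bigcup_BLeft_shift true 0 0) setX_bigcupr.
apply/measurable_fun_bigcup => i.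
  by apply: measurableX => //; exact: measurable_itv.
by apply: right_cont_measurable_prod => [s /andP[s0 _]|w s /andP[s0 _]]; auto.
Qed.

End right_continuous_processes.

(** * Dyadic approximation of a first passage time *)

Section dyadic_stopping.
Context {R : realType}.
Implicit Types (a : pred R) (p : R -> R).

Definition dyadic m i : R := i%:R / 2 ^+ m.

(* Equal to 2 ^ m, i.e. to time 1, when [a] holds at none of the points. *)
Definition first_dyadic a m : nat := find (a \o dyadic m) (iota 0 (2 ^ m)).

Lemma dyadic_unit m i : (i <= 2 ^ m)%N -> 0 <= dyadic m i <= 1.
Proof.
move=> im; rewrite /dyadic divr_ge0//=.
by rewrite ler_pdivrMr ?exprn_gt0// mul1r -natrX ler_nat.
Qed.

Lemma first_dyadic_le a m : (first_dyadic a m <= 2 ^ m)%N.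
Proof. by rewrite (leq_trans (find_size _ _))// size_iota. Qed.

Lemma first_dyadic_before a m i : (i < first_dyadic a m)%N -> ~~ a (dyadic m i).
Proof.
move=> im; have := before_find 0%N im; rewrite nth_iota /=; first by move=> ->.
exact: leq_trans im (first_dyadic_le a m).
Qed.

Lemma first_dyadic_at a m : (first_dyadic a m < 2 ^ m)%N ->
  a (dyadic m (first_dyadic a m)).
Proof.
move=> im; have := @nth_find _ 0%N (a \o dyadic m) (iota 0 (2 ^ m)).
by rewrite has_find size_iota => /(_ im); rewrite nth_iota.
Qed.

(** The right-hand side involves only indices up to [i], so that stopping at [i] is decided at time
    [dyadic m i]. Nothing is asked at [i = 2 ^ m], the default value. *)
Lemma first_dyadicP a m i : (i <= 2 ^ m)%N ->
  first_dyadic a m = i <->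
  (forall j, (j < i)%N -> ~~ a (dyadic m j)) /\ ((i < 2 ^ m)%N -> a (dyadic m i)).
Proof.
move=> im; split => [<-|[bi ai]].
  by split; [move=> j; exact: first_dyadic_before|exact: first_dyadic_at].
apply/eqP; rewrite eqn_leq; apply/andP; split; rewrite leqNgt; apply/negP => h.
  have /negP := first_dyadic_before h; apply.
  exact/ai/(leq_trans h)/first_dyadic_le.
have /negP := bi _ h; apply; apply: first_dyadic_at.
exact: leq_trans h im.
Qed.

Lemma dyadic_double m i : dyadic m.+1 i.*2 = dyadic m i.
Proof.
by rewrite /dyadic exprS -muln2 natrM mulrC; field; rewrite expf_neq0// pnatr_eq0.
Qed.

(** Each grid is contained in the next one, so refining it can only lead to an earlier stop. *)
Lemma first_dyadic_double a m : (first_dyadic a m.+1 <= (first_dyadic a m).*2)%N.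
Proof.
rewrite leqNgt; apply/negP => h; have /negP := first_dyadic_before h; apply.
rewrite dyadic_double; apply: first_dyadic_at.
by rewrite -ltn_double -[(2 ^ m).*2]mul2n -expnS; exact: leq_trans h (first_dyadic_le _ _).
Qed.

Lemma right_dyadic_approx (s : R) : 0 <= s -> exists i : nat -> nat,
  (forall m, s < dyadic m (i m)) /\ dyadic m (i m) @[m --> \oo] --> s.
Proof.
move=> s0; pose i m := (Num.trunc (s * 2 ^+ m)).+1; exists i.
have p2 m : 0 < 2 ^+ m :> R by rewrite exprn_gt0.
have h m : (Num.trunc (s * 2 ^+ m))%:R <= s * 2 ^+ m < (i m)%:R.
  by apply: truncn_itv; rewrite mulr_ge0// ltW.
split=> [m|]; first by rewrite /dyadic ltr_pdivlMr//; case/andP: (h m).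
apply: (@squeeze_cvgr _ _ _ _ (cst s) (fun m => s + (2 ^+ m)^-1)).
- near=> m; have /andP[h1 h2] := h m; apply/andP; split.
    by rewrite /dyadic ler_pdivlMr// ltW.
  by rewrite /dyadic /i ler_pdivrMr// mulrDl mulVf ?gt_eqF// -natr1 lerD2r.
- exact: cvg_cst.
- rewrite -[X in _ --> X]addr0; apply: cvgD; first exact: cvg_cst.
  under eq_fun do rewrite -exprVn.
  by apply: cvg_expr; rewrite ger0_norm ?invr_ge0// invf_lt1// ltr1n.
Unshelve. all: by end_near. Qed.

(* [tau] decreases to some sigma > 0, and p <= c on [0, sigma[ by right continuity. *)
Lemma stopped_Rintegral_cvg p (c : R) : c < 0 -> p 0 < c ->
  (forall s, 0 <= s < 1 -> p u @[u --> s^'+] --> p s) ->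
  (@lebesgue_measure R).-integrable `[0, 1] (EFin \o p) ->
  let tau m := dyadic m (first_dyadic (fun s => c <= p s) m) in
  exists2 l : R, l < 0 &
    (\int[lebesgue_measure]_(s in `[0, tau m[) p s) @[m --> \oo] --> l.
Proof.
move=> c0 p0 cp ip tau; pose a s := c <= p s.
have tau01 m : 0 <= tau m <= 1 by apply/dyadic_unit/first_dyadic_le.
have tauS : nonincreasing_seq tau.
  apply/nonincreasing_seqP => m; rewrite /tau -[leRHS]dyadic_double /dyadic.
  by rewrite ler_pM2r ?invr_gt0 ?exprn_gt0// ler_nat first_dyadic_double.
have lbtau : has_lbound (range tau).
  by exists 0 => _ [m _ <-]; case/andP: (tau01 m).
have := nonincreasing_cvgn tauS lbtau; set sigma := inf _ => taucvg.
have sle m : sigma <= tau m by apply: ge_inf => //; exists m.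
have [d d0 pd] : exists2 d, 0 < d & forall s, 0 <= s < d -> p s < c.
  have : p u @[u --> 0^'+] --> p 0 by apply: cp; rewrite lexx ltr01.
  move/cvgr_lt => /(_ _ p0) [d /= d0 H]; exists d => // s /andP[s0 sd].
  move: s0; rewrite le_eqVlt => /predU1P[<-//|s0].
  by apply: H => //=; rewrite sub0r normrN gtr0_norm.
(* No dyadic time before [d] meets the stopping condition, so each [tau m] is at least [d] or is the
   default value 1. *)
have sigma0 : 0 < sigma.
  apply: (@lt_le_trans _ _ (Num.min d 1)); first by rewrite lt_min d0 ltr01.
  apply: lb_le_inf; first by exists (tau 0%N); exists 0%N.
  move=> _ [m _ <-]; have [|mlt] := leqP (2 ^ m) (first_dyadic a m).
    move=> h; rewrite ge_min; apply/orP; right.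
    have fE : first_dyadic a m = (2 ^ m)%N.
      by apply/eqP; rewrite eqn_leq first_dyadic_le.
    by rewrite /tau fE /dyadic natrX divff// expf_neq0.
  rewrite leNgt; apply/negP; rewrite lt_min => /andP[h _].
  have := first_dyadic_at mlt; rewrite /a leNgt => /negP; apply; apply: pd.
  by rewrite h andbT; case/andP: (tau01 m).
have sigma1 : sigma <= 1 by apply: le_trans (sle 0%N) _; case/andP: (tau01 0%N).
(* A dyadic time of level [m] below [sigma], hence below [tau m], was tested without stopping; such
   times approach [s] from the right. *)
have ple s : 0 <= s < sigma -> p s <= c.
  move=> /andP[s0 ss]; have [i [si ci]] := right_dyadic_approx s0.
  have /cvg_at_rightP cps : p u @[u --> s^'+] --> p s.
    by apply: cp; rewrite s0 (lt_le_trans ss).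
  have /= pcv := cps _ (conj si ci).
  apply: cvgr_to_le pcv _.
  have /cvgr_lt /(_ _ ss) := ci; apply: filterS => m im.
  rewrite ltW// ltNge; apply: (@first_dyadic_before a m).
  have := lt_le_trans im (sle m).
  by rewrite /tau /dyadic ltr_pM2r ?invr_gt0 ?exprn_gt0// ltr_nat.
pose n (x : R) := \int[lebesgue_measure]_(s in `[0, x[) p s.
have nE x : 0 <= x <= 1 -> n x = parameterized_integral lebesgue_measure 0 x p.
  move=> /andP[x0 x1]; rewrite /n /parameterized_integral Rintegral_itv_bndo_bndc//.
  apply: integrableS ip => //.
  by apply: subset_itvl; rewrite bnd_simp.
exists (n sigma).
  have -> : n sigma = \int[lebesgue_measure]_(s in `[0, sigma[) p s by [].
  apply: (@le_lt_trans _ _ (\int[@lebesgue_measure R]_(s in `[0, sigma[) c)).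
    apply: le_Rintegral => //.
    - apply: integrableS ip => //.
      by apply: subset_itvl; rewrite bnd_simp.
    - apply: measurable_bounded_integrable => //.
        by rewrite /= lebesgue_measure_itv/=; case: ifP => _; rewrite ltry.
      exact: bounded_cst.
  rewrite Rintegral_cst//= lebesgue_measure_itv/= lte_fin sigma0 sube0/=.
  by rewrite nmulr_rlt0.
have := @parameterized_integral_continuous R 0 1 p ler01 ip.
move=> /(_ sigma) /= cn.
rewrite [X in _ --> X]nE ?(ltW sigma0)//.
under eq_fun do rewrite -/(n _) nE//.
have sigma01 : `[0, 1]%classic sigma by rewrite /= in_itv/= (ltW sigma0).
(* The primitive is only continuous relative to [0, 1], which is enough as [tau] stays there;
   [sigma] may be the endpoint 1. *)
have tauw : tau m @[m --> \oo] --> within `[0, 1] (nbhs sigma).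
  move=> U wU; suff : \forall m \near \oo, U (tau m) by [].
  have : \forall m \near \oo, `[0, 1]%classic (tau m) -> U (tau m) := taucvg _ wU.
  by apply: filterS => m; apply; rewrite /= in_itv/=; exact: tau01.
exact: (cvg_comp _ _ ((subspace_cvgP _ sigma01).2 tauw) cn).
Qed.

End dyadic_stopping.

(** * Measurability with respect to the filtration *)

Section natural_filtration.
Context {R : realType} (B : Defs.basis R).

(** The sample space with [filt t] as its sigma-algebra: [filt t]-measurability becomes an instance
    of [measurable_fun]. For negative [t] the generated sigma-algebra may be larger than [filt t],
    whence the premises [0 <= t] below. *)
Definition past (t : R) : measurableType (sigma_display (@filt R B t)) :=
  g_sigma_algebraType (@filt R B t).

Lemma measurable_pastE t (G : set B) : 0 <= t ->
  measurable (G : set (past t)) = filt t G.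
Proof.
move=> t0; rewrite /measurable/=.
by rewrite (sigma_algebra_id (@filt_sigma R B t t0)).
Qed.

Lemma past_measurable_fun d (T : measurableType d) t (Y : B -> T) : 0 <= t ->
  measurable_fun (setT : set (past t)) Y -> measurable_fun setT Y.
Proof.
move=> t0 mY _ U mU; apply: (@filt_sub R B t t0); rewrite -measurable_pastE//.
exact: mY.
Qed.

Lemma past_mono d (T : measurableType d) s t (Y : B -> T) : 0 <= s -> s <= t ->
  measurable_fun (setT : set (past s)) Y -> measurable_fun (setT : set (past t)) Y.
Proof.
move=> s0 st mY _ U mU; rewrite measurable_pastE ?(le_trans s0)//.
apply: (@filt_mono R B s t s0 st); rewrite -measurable_pastE//.
exact: mY.
Qed.

Lemma filtT t : 0 <= t -> filt t [set: B].
Proof. by move=> t0; rewrite -measurable_pastE//; exact: measurableT. Qed.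

End natural_filtration.

(** * Martingales that are integrals of a right-continuous rate *)

(** Otherwise the positive part [q] of [g - 1] has integral 0 and vanishes almost surely, although
    it is almost surely positive. This strictness is what contradicts the bound from Fatou's
    lemma. *)
Lemma expectation_gt1 d (T : measurableType d) (R : realType)
    (P : probability T R) (g : T -> \bar R) :
  measurable_fun setT g -> (forall w, 0 <= g w)%E ->
  {ae P, forall w, (1 < g w)%E} -> (1 < \int[P]_w g w)%E.
Proof.
move=> mg g0 g1; rewrite ltNge; apply/negP => le1.
pose q w := maxe (g w - 1)%E 0%E.
have mq : measurable_fun setT q.
  by apply: measurable_maxe => //; exact: emeasurable_funB.
have q0 w : (0 <= q w)%E by rewrite /q le_max lexx orbT.
have gq : (\int[P]_w g w = \int[P]_w (1 + q w))%E.
  apply: ge0_ae_eq_integral => //.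
  - by apply: emeasurable_funD.
  - by move=> w _; exact: adde_ge0.
  - apply: filterS g1 => w g1 _.
    rewrite /q max_l; first by rewrite addeC subeK.
    by rewrite sube_ge0 ?ltW.
move: le1; rewrite gq ge0_integralD//= integral_cst// mul1e [X in (X + _)%E](probability_setT P).
rewrite -[leRHS]adde0 leeD2lE// => qle0.
have qE : (\int[P]_w `|q w| = 0)%E.
  under eq_integral do rewrite gee0_abs//.
  by apply/eqP; rewrite eq_le qle0 integral_ge0.
have := (ae_eq_integral_abs P measurableT mq).1 qE.
move=> q_ae; have : {ae P, forall w, False}.
  apply: filterS2 g1 q_ae => w g1 /(_ I)/=; rewrite /q.
  by rewrite max_l ?sube_ge0 ?ltW// => gE; rewrite -sube_gt0 gE ltxx in g1.
move=> /negligibleP; rewrite (_ : ~` _ = setT); last by apply/seteqP; split => // w _ [].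
by move=> /(_ measurableT)/eqP; rewrite [X in X == _](probability_setT P) onee_eq0.
Qed.

Section finite_variation_martingale.
Context (R : realType) (B : Defs.basis R).
Local Notation P := (prob B).
Variables (k : R -> B -> R) (c : R).

Let N t w : \bar R := (\int[@lebesgue_measure R]_(s in `[0%R, t[) (k s w)%:E)%E.

Hypothesis mk : forall t, 0 <= t -> measurable_fun (setT : set (past B t)) (k t).
Hypothesis ck : forall w s, 0 <= s -> k u w @[u --> s^'+] --> k s w.
Hypothesis ik : {ae P, forall w,
  (@lebesgue_measure R).-integrable `[0, 1] (fun s => (k s w)%:E)}.
Hypothesis iN : forall t, 0 <= t -> P.-integrable setT (N t).
Hypothesis martN : forall s t, 0 <= s -> s <= t -> forall G, filt s G ->
  (\int[P]_(w in G) N t w = \int[P]_(w in G) N s w)%E.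
Hypothesis k0 : forall w, k 0 w = c.

(** For [c < 0] the threshold lies strictly between the initial rate [c] and 0: the rate starts
    below it and is still negative at each dyadic time tested before the stop. *)
Let stop m w := first_dyadic (fun s => c / 2 <= k s w) m.

Let F m i := [set w : B | stop m w = i /\ (N (dyadic m i) w <= 1)%E].

Let mN t : 0 <= t -> measurable_fun (setT : set (past B t)) (N t).
Proof.
move=> t0; apply: right_cont_measurable_integral.
  by move=> s /andP[s0 st]; apply: past_mono st (mk s0).
by move=> w s /andP[s0 _]; exact: ck.
Qed.

Let filtF m i : (i <= 2 ^ m)%N -> filt (dyadic m i) (F m i).
Proof.
move=> im; have /andP[d0 d1] := @dyadic_unit R _ _ im.
rewrite -measurable_pastE//.
have ma j : (j <= i)%N ->
    measurable ([set w | c / 2 <= k (dyadic m j) w] : set (past B (dyadic m i))).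
  move=> ji; rewrite (_ : mkset _ = k (dyadic m j) @^-1` `[c / 2, +oo[); last first.
    by apply/seteqP; split => w /=; rewrite in_itv/= andbT.
  rewrite -[X in measurable X]setTI.
  have /andP[dj0 _] := @dyadic_unit R _ _ (leq_trans ji im).
  apply: past_mono (mk dj0) _ _ _ => //.
  by rewrite /dyadic ler_pM2r ?invr_gt0 ?exprn_gt0// ler_nat.
rewrite (_ : F m i = (\bigcap_j [set w | (j < i)%N -> ~~ (c / 2 <= k (dyadic m j) w)])
   `&` [set w | (i < 2 ^ m)%N -> c / 2 <= k (dyadic m i) w]
   `&` (N (dyadic m i) @^-1` `]-oo, 1%E])); last first.
  apply/seteqP; split => w.
    move=> [/(first_dyadicP _ im)[bi ai] N1]; split; last by rewrite /= in_itv.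
    by split => [j _ /=|//]; exact: bi.
  move=> [[bi ai]]; rewrite /= in_itv/= => N1; split => //.
  by apply/(first_dyadicP _ im); split => // j; apply: bi.
apply: measurableI; first apply: measurableI.
- apply: bigcapT_measurable => j; have [ji|ji] := ltnP j i.
    rewrite (_ : mkset _ = ~` [set w | c / 2 <= k (dyadic m j) w]).
      by apply: measurableC; apply: ma; exact: ltnW.
    by apply/seteqP; split => w /=; [move=> /(_ isT)/negP|move=> /negP].
  rewrite (_ : mkset _ = setT); first exact: measurableT.
  by apply/seteqP; split => w //=.
- have [im'|im'] := ltnP i (2 ^ m).
    rewrite (_ : mkset _ = [set w | c / 2 <= k (dyadic m i) w]); first exact: ma.
    by apply/seteqP; split => w /=; [apply|].
  rewrite (_ : mkset _ = setT); first exact: measurableT.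
  by apply/seteqP; split => w //=.
- rewrite -[X in measurable X]setTI.
  by apply: (mN d0) => //; exact: emeasurable_itv.
Qed.

Let measF m i : measurable (F m i).
Proof.
have [im|im] := leqP i (2 ^ m).
  have /andP[d0 _] := @dyadic_unit R _ _ im.
  exact: (@filt_sub R B _ d0 _ (filtF im)).
rewrite (_ : F m i = set0)//; apply/seteqP; split => w // [si _].
by move: im; rewrite -si ltnNge first_dyadic_le.
Qed.

Let trivF m : trivIset setT (F m).
Proof. by move=> i j _ _ [w [[<- _] [<- _]]]. Qed.

Let H m := \bigcup_i F m i.

Let mH m : measurable (H m). Proof. exact: bigcupT_measurable. Qed.

Let Ntau m w := N (dyadic m (stop m w)) w.

Let NtauF m i w : F m i w -> Ntau m w = N (dyadic m i) w.
Proof. by move=> [<-]. Qed.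

Let mNtau m : measurable_fun (H m) (Ntau m).
Proof.
apply/(measurable_fun_bigcup _ (measF m)) => i.
have [im|im] := leqP i (2 ^ m); last first.
  rewrite (_ : F m i = set0); first exact: measurable_fun_set0.
  apply/seteqP; split => w // [si _].
  by move: im; rewrite -si ltnNge first_dyadic_le.
have /andP[d0 _] := @dyadic_unit R _ _ im.
apply: (eq_measurable_fun (N (dyadic m i))).
  by move=> w /[!inE] Fw; rewrite (NtauF Fw).
by apply: measurable_funTS; exact: past_measurable_fun (mN d0).
Qed.

Let Ntau_le1 m w : H m w -> (Ntau m w <= 1)%E.
Proof. by move=> [i _ Fw]; rewrite (NtauF Fw); case: Fw. Qed.

(** The event [F m i] is known at time [dyadic m i], so the martingale identity between this time
    and 1 applies to each piece. The truncation lets the left-hand pieces be summed by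
    nonnegativity, without integrability of [Ntau m]; the right-hand ones are summed by
    integrability of [N 1]. *)
Let stopping_identity m :
  (\int[P]_(w in H m) (1 - Ntau m w) = \int[P]_(w in H m) (1 - N 1 w))%E.
Proof.
have i1N t (A : set B) : 0 <= t -> measurable A ->
    P.-integrable A (fun w => (1 - N t w)%E).
  move=> t0 mA; apply: integrableB => //.
    exact: finite_measure_integrable_cst.
  by apply: integrableS (iN t0).
rewrite ge0_integral_bigcup//; last 2 first.
- by apply: emeasurable_funB => //; exact: mNtau.
- move=> w Hw; rewrite subre_ge0//; exact: Ntau_le1.
rewrite (integral_bigcup (@trivF m) (measF m) (i1N 1 (H m) ler01 (mH m))).
apply: eq_eseriesr => i _.
have [im|im] := leqP i (2 ^ m); last first.
  rewrite (_ : F m i = set0) ?integral_set0//.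
  apply/seteqP; split => w // [si _].
  by move: im; rewrite -si ltnNge first_dyadic_le.
have /andP[d0 d1] := @dyadic_unit R _ _ im.
transitivity (\int[P]_(w in F m i) (1 - N (dyadic m i) w))%E.
  by apply: eq_integral => w /[!inE] Fw; rewrite (NtauF Fw).
have i1 : P.-integrable (F m i) (cst 1%E).
  exact: finite_measure_integrable_cst.
have iNF t : 0 <= t -> P.-integrable (F m i) (N t).
  by move=> t0; apply: integrableS (iN t0).
have := integralB (measF m i) i1 (iNF _ d0) => /= ->.
have := integralB (measF m i) i1 (iNF _ ler01) => /= ->.
by rewrite (martN d0 d1 (filtF im)).
Qed.

Let EN1 : (\int[P]_w N 1 w = 0)%E.
Proof.
rewrite (martN (lexx 0) ler01 (filtT B (lexx 0))).
apply: integral0_eq => w _; rewrite /N set_itv_ge ?integral_set0//.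
by rewrite bnd_simp ltxx.
Qed.

(* If c < 0, stop N at the first dyadic time of level m at which k >= c / 2. These
   times decrease to a positive limit, at which N is negative. As N need not be
   uniformly integrable a priori, optional stopping is only used on the event H m
   that the stopped value is at most 1: there the stopped value and N 1 have the
   same expectation, which tends to E[N 1] = 0, while Fatou's lemma makes the limit
   of the stopped expectations negative. *)
Lemma finite_variation_martingale_ge0 : 0 <= c.
Proof.
rewrite leNgt; apply/negP => c0.
pose h m := (fun w => 1 - Ntau m w)%E \_ (H m).
have mh m : measurable_fun setT (h m).
  have m1 : measurable_fun (H m) (fun w => 1 - Ntau m w)%E.
    by apply: emeasurable_funB => //; exact: mNtau.
  exact: (measurable_restrictT _ (mH m)).1 m1.
have h0 m w : (0 <= h m w)%E.
  rewrite /h patchE; case: ifPn => // /[!inE] Hw.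
  by rewrite subre_ge0//; exact: Ntau_le1.
pose g w : \bar R := limn_einf (h ^~ w).
have mg : measurable_fun setT g.
  have -> : g = (fun w => - limn_esup (fun m => - h m w))%E.
    apply/funext => w; rewrite /g -limn_einfN; congr limn_einf.
    by apply/funext => m /=; rewrite oppeK.
  apply: measurableT_comp => //.
  by apply: (measurable_fun_limn_esup (f := fun m w => - h m w)%E) => m; exact: measurableT_comp.
have hcvg : {ae P, forall w, exists2 l : R, l < 0 & Ntau m w @[m --> \oo] --> l%:E}.
  apply: filterS ik => w ikw.
  have [] := @stopped_Rintegral_cvg R (k ^~ w) (c / 2).
  - by rewrite ltr_pdivrMr ?mul0r.
  - by rewrite k0; lra.
  - by move=> s /andP[s0 _]; exact: ck.
  - exact: ikw.
  move=> l l0 lcvg; exists l => //.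
  have NE m : Ntau m w = (\int[lebesgue_measure]_(s in `[0, dyadic m (stop m w)[) k s w)%:E.
    rewrite /Ntau /N /Rintegral fineK//.
    apply: integrable_fin_num => //.
    apply: integrableS ikw => //; apply: subset_itvl; rewrite bnd_simp.
    by have /andP[] := @dyadic_unit R _ _ (first_dyadic_le (fun s => c / 2 <= k s w) m).
  under eq_fun do rewrite NE.
  by apply/fine_cvgP; split => //; apply: nearW => m.
(* The truncation disappears in the limit: a negative limit of [Ntau m w] is below 1. *)
have Hnear : {ae P, forall w, \forall m \near \oo, H m w}.
  move: hcvg; apply: filterS => w [l l0 /fine_cvgP[fin cvl]].
  have l1 : l < 1 by apply: lt_trans l0 ltr01.
  have : \forall m \near \oo, fine (Ntau m w) < 1 by exact: cvgr_lt cvl _ l1.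
  apply: filterS2 fin => m fin l1m.
  exists (stop m w) => //; split => //.
  by rewrite -[X in (X <= _)%E]/(Ntau m w) -(fineK fin) lee_fin ltW.
have g1 : {ae P, forall w, (1 < g w)%E}.
  move: hcvg Hnear; apply: filterS2 => w [l l0 cvl] Hw.
  have cvh : h m w @[m --> \oo] --> (1 - l%:E)%E.
    apply: cvg_trans (cvgeB _ (cvg_cst 1%E) cvl) => //.
    apply: near_eq_cvg; apply: filterS Hw => m Hm.
    by rewrite /h patchE mem_set.
  by rewrite /g (cvg_limn_einf_sup cvh).1 -EFinB lte_fin ltrBrDr gtrDl.
have g0 w : (0 <= g w)%E.
  rewrite /g limn_einf_lim; apply: lime_ge; first exact: is_cvg_einfs.
  by apply: nearW => m; apply: le_ereal_inf_tmp => _ [j _ <-]; exact: h0.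
have := expectation_gt1 mg g0 g1; apply/negP; rewrite -leNgt.
apply: (le_trans (fatou P measurableT mh (fun m w _ => h0 m w))).
have iM : P.-integrable setT (fun w => 1 - N 1 w)%E.
  apply: integrableB => //; last exact: iN.
  exact: finite_measure_integrable_cst.
have mM := measurable_int P iM.
have M1 : (\int[P]_w (1 - N 1 w) = 1)%E.
  have i1 : P.-integrable setT (cst 1%E) by exact: finite_measure_integrable_cst.
  have := integralB measurableT i1 (iN ler01) => /= ->.
  by rewrite EN1 sube0 integral_cst// mul1e [LHS](probability_setT P).
have hE m : (\int[P]_w h m w = \int[P]_w ((fun w => 1 - N 1 w) \_ (H m)) w)%E.
  by rewrite -!integral_mkcond stopping_identity.
suff hcv : (\int[P]_w h m w)%E @[m --> \oo] --> 1%E by rewrite (cvg_limn_einf_sup hcv).1.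
under eq_fun do rewrite hE.
have [] := @dominated_convergence _ _ R P setT measurableT
  (fun m => (fun w => 1 - N 1 w)%E \_ (H m)) (fun w => 1 - N 1 w)%E
  (fun w => `|1 - N 1 w|)%E.
- move=> m; apply: (measurable_restrictT _ (mH m)).1; exact: measurable_funTS.
- exact: mM.
- move: Hnear; apply: filterS => w Hw _; apply: cvg_near_cst.
  by move: Hw; apply: filterS => m Hm; rewrite patchE mem_set.
- exact: integrable_abse.
- apply: nearW => w m _; rewrite patchE; case: ifP => // _.
  by rewrite abse0.
by rewrite M1 => _ _; exact.
Qed.

End finite_variation_martingale.

(** * Translation of integrals on a half-line *)

Lemma lebesgue_measure_translate (R : realType) (t : R) (A : set R) : measurable A ->
  lebesgue_measure ((fun s => t + s) @^-1` A) = lebesgue_measure A.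
Proof.
move=> mA.
pose phi0 : measurableTypeR R -> measurableTypeR R := fun s => t + s.
have mphi : measurable_fun setT phi0 by exact: measurable_funD.
pose phi_mixin := isMeasurableFun.Build _ _ _ _ _ mphi.
pose phi : {mfun (measurableTypeR R) >-> (measurableTypeR R)} := HB.pack phi0 phi_mixin.
apply/esym/(@lebesgue_measure_unique R (pushforward lebesgue_measure phi)) => //.
move=> _ [[a b]] _ <-; rewrite /pushforward /=.
transitivity (lebesgue_measure `]a - t, b - t]%classic); last first.
  congr lebesgue_measure; apply/seteqP; split => s /=;
  by rewrite /phi0 !in_itv/= ltrBlDl lerBrDl.
rewrite !lebesgue_measure_itv/= !lte_fin ltrD2r; case: ifP => // _.
by rewrite -!EFinB; congr EFin; ring.
Qed.

Lemma ge0_integral_translate (R : realType) (t : R) (F : R -> \bar R) :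
  measurable_fun `[t, +oo[ F -> (forall s, t <= s -> (0 <= F s)%E) ->
  (\int[lebesgue_measure]_(s in `[t, +oo[) F s =
   \int[lebesgue_measure]_(s in `[0%R, +oo[) F (t + s)%R)%E.
Proof.
move=> mF F0.
have mphi : measurable_fun setT ((fun s => t + s) : measurableTypeR R -> measurableTypeR R).
  exact: measurable_funD.
have -> : `[0, +oo[%classic = (fun s => t + s) @^-1` `[t, +oo[.
  by apply/seteqP; split => s /=; rewrite !in_itv/= !andbT lerDl.
have := @ge0_integral_pushforward _ _ (measurableTypeR R) (measurableTypeR R) R _ mphi
  lebesgue_measure `[t, +oo[ F; rewrite /comp => <- //.
- apply: eq_measure_integral => A mA _; exact/esym/lebesgue_measure_translate.
- by move=> y; rewrite inE/= in_itv/= andbT; exact: F0.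
Qed.

(** * Exit times, futures and killed integrands *)

Section exit_time_theory.
Context {R : realType} {S : topologicalType} (D : set S).
Hypothesis oD : open D.
Implicit Types (w : R -> S) (t s : R).

Definition path_right_cont w := forall t, 0 <= t -> w s @[s --> t^'+] --> w t.

Lemma exit_time_ge0 w : (0 <= exit_time D w)%E.
Proof. by apply: le_ereal_inf_tmp => _ [t [t0 _] <-]; rewrite lee_fin. Qed.

Lemma before_exit_time w t : 0 <= t -> (t%:E < exit_time D w)%E -> D (w t).
Proof.
move=> t0; rewrite ltNge => /negP h; apply: contrapT => nD; apply: h.
by apply: ereal_inf_lbound; exists t.
Qed.

(** The infimum is attained: were [w r] in the open set [D], right continuity would keep the path in
    [D] up to some [r + d], before which times outside [D] occur. *)
Lemma exit_time_out w r : path_right_cont w -> exit_time D w = r%:E -> ~ D (w r).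
Proof.
move=> cw er Dr.
have r0 : 0 <= r by rewrite -lee_fin -er exit_time_ge0.
have : \forall s \near r^'+, D (w s).
  by apply: (cw _ r0); apply: open_nbhs_nbhs.
move=> [d /= d0 Hd].
have : (exit_time D w < (r + d)%:E)%E by rewrite er lte_fin ltrDl.
rewrite /exit_time => /ereal_inf_lt[_ [s [s0 nDs] <-]]; rewrite lte_fin => sd.
have : r <= s by rewrite -lee_fin -er; apply: ereal_inf_lbound; exists s.
rewrite le_eqVlt => /predU1P[rs|rs]; apply: nDs; first by rewrite -rs.
apply: Hd => //=.
by rewrite ltr0_norm ?subr_lt0// opprB ltrBlDl.
Qed.

Lemma stop_at_before w t : 0 <= t -> (t%:E <= exit_time D w)%E -> stop_at D w t = t.
Proof. by move=> t0 te; rewrite /stop_at max_r// min_l. Qed.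

Lemma stop_at_after w t r : exit_time D w = r%:E -> r <= t -> stop_at D w t = r.
Proof.
move=> er rt; have r0 : 0 <= r by rewrite -lee_fin -er exit_time_ge0.
by rewrite /stop_at er max_r ?(le_trans r0)// min_r// lee_fin.
Qed.

Lemma stopped_before w t : 0 <= t -> (t%:E < exit_time D w)%E -> stopped D w t = w t.
Proof. by move=> t0 te; rewrite /stopped stop_at_before// ltW. Qed.

Lemma stopped_after w t r : exit_time D w = r%:E -> r <= t -> stopped D w t = w r.
Proof. by move=> er rt; rewrite /stopped (stop_at_after er). Qed.

Lemma stopped0 w : stopped D w 0 = w 0.
Proof. by rewrite /stopped stop_at_before// exit_time_ge0. Qed.

(* The Markov property speaks of stopped paths on one side and of futures on the other. *)
Lemma stopped_future w : stopped D w = future D w 0.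
Proof.
by apply/funext => s; rewrite /future /stopped /stop_at add0r maxA maxxx.
Qed.

Lemma futureE w t s : 0 <= t -> 0 <= s -> ((t + s)%:E < exit_time D w)%E ->
  future D w t s = w (t + s).
Proof. by move=> t0 s0 h; rewrite /future max_r// stopped_before// addr_ge0. Qed.

(** [future] follows the stopped path, so a finite exit is visible in it only because the infimum is
    attained. *)
Lemma exit_time_future w t : path_right_cont w -> 0 <= t -> (t%:E < exit_time D w)%E ->
  exit_time D (future D w t) = (exit_time D w - t%:E)%E.
Proof.
move=> cw t0 te; apply/eqP; rewrite eq_le; apply/andP; split.
  case er : (exit_time D w) => [r| |].
  - rewrite -EFinB; apply: ereal_inf_lbound; exists (r - t) => //.
    have tr : t <= r by rewrite -lee_fin -er ltW.
    split; first by rewrite subr_ge0.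
    rewrite /future max_r ?subr_ge0// addrC subrK (stopped_after er)//.
    exact: exit_time_out.
  - by rewrite leey.
  - by have := exit_time_ge0 w; rewrite er.
apply: le_ereal_inf_tmp => _ [s [s0 nD] <-].
rewrite leeBlDr// -EFinD addrC leNgt; apply/negP => h; apply: nD.
by rewrite futureE//; apply: before_exit_time => //; exact: addr_ge0.
Qed.

(** The inequality is strict, so the drop to 0 takes place at the exit time itself and right
    continuity is kept, whatever [psi] is outside [D]. *)
Definition killed (psi : S -> R) w s : R :=
  if (s%:E < exit_time D w)%E then psi (w s) else 0.

Lemma killed_right_cont psi w : (forall y, D y -> {for y, continuous psi}) ->
  path_right_cont w ->
  forall s, 0 <= s -> killed psi w u @[u --> s^'+] --> killed psi w s.
Proof.
move=> cpsi cw s s0; rewrite {2}/killed; case: ifPn => se.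
  have Ds := before_exit_time s0 se.
  have h : psi (w u) @[u --> s^'+] --> psi (w s) by apply: cvg_comp (cw _ s0) (cpsi _ Ds).
  apply: cvg_trans h; apply: near_eq_cvg.
  have [d d0 Hd] : exists2 d, 0 < d & ((s + d)%:E <= exit_time D w)%E.
    case er : (exit_time D w) => [r| |].
    - exists (r - s); first by rewrite subr_gt0 -lte_fin -er.
      by rewrite addrC subrK.
    - by exists 1 => //; rewrite leey.
    - by have := exit_time_ge0 w; rewrite er.
  near=> u; rewrite /killed ifT//; apply: lt_le_trans Hd; rewrite lte_fin.
  by near: u; apply: nbhs_right_lt; rewrite ltrDl.
apply: cvg_near_cst; near=> u; rewrite /killed ifN// -leNgt.
move: se; rewrite -leNgt => /le_trans; apply; rewrite lee_fin ltW//.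
Unshelve. all: by end_near. Qed.

Lemma measurable_before_exit w u : measurable (before_exit D w u).
Proof.
apply: is_interval_measurable => a b [a0 _] [b0 bu] x /andP[ax xb].
split; first exact: le_trans ax.
by apply: le_lt_trans bu; rewrite lee_fin.
Qed.

Lemma before_exit0 w : before_exit D w 0%E = set0.
Proof.
apply/seteqP; split => s // [s0]; rewrite lt_min lte_fin => /andP[/(le_lt_trans s0)].
by rewrite ltxx.
Qed.

Lemma before_exit_restrict (psi : S -> R) w (u : \bar R) (F : R -> R) :
  (forall s, 0 <= s -> (s%:E < exit_time D w)%E -> F s = psi (w s)) ->
  F \_ (before_exit D w u) = (killed psi w) \_ [set s | 0 <= s /\ (s%:E < u)%E].
Proof.
move=> FE; apply/funext => s; rewrite !patchE.
have [[s0 su]|nb] := pselect (before_exit D w u s).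
  move: (su); rewrite lt_min => /andP[su' se].
  rewrite mem_set; last by split.
  by rewrite mem_set// /killed se FE.
rewrite memNset//; case: ifPn => // /[!inE]/= -[s0 su].
rewrite /killed ifN//; apply/negP => se; apply: nb; split => //.
by rewrite lt_min su.
Qed.

Lemma set_lt_EFin t : [set s : R | 0 <= s /\ (s%:E < t%:E)%E] = `[0, t[%classic.
Proof.
apply/seteqP; split => s /=; rewrite in_itv/= lte_fin.
  by move=> [-> ->].
by move=> /andP[].
Qed.

Lemma set_lt_pinfty : [set s : R | 0 <= s /\ (s%:E < +oo)%E] = `[0, +oo[%classic.
Proof.
apply/seteqP; split => s /=; rewrite in_itv/= andbT; first by case.
by move=> s0; split=> //; rewrite ltry.
Qed.

Section integral_before_exit.
Variables (psi : S -> R) (w : R -> S) (F : R -> R).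
Hypothesis FE : forall s, 0 <= s -> (s%:E < exit_time D w)%E -> F s = psi (w s).

Lemma integral_before_exit u : (\int[@lebesgue_measure R]_(s in before_exit D w u) (F s)%:E =
  \int[@lebesgue_measure R]_(s in [set s : R | (0 <= s)%R /\ s%:E < u]) (killed psi w s)%:E)%E.
Proof.
rewrite integral_mkcond [RHS]integral_mkcond.
congr integral; rewrite [LHS](restrict_EFin F) [RHS](restrict_EFin (killed psi w)).
by rewrite (before_exit_restrict _ FE).
Qed.

Lemma Rintegral_before_exit u : \int[@lebesgue_measure R]_(s in before_exit D w u) F s =
  \int[@lebesgue_measure R]_(s in [set s | 0 <= s /\ (s%:E < u)%E]) killed psi w s.
Proof. by rewrite /Rintegral integral_before_exit. Qed.

Lemma integrable_before_exit t :
  (@lebesgue_measure R).-integrable (before_exit D w t%:E) (fun s => (F s)%:E) ->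
  (@lebesgue_measure R).-integrable `[0, t[ (fun s => (killed psi w s)%:E).
Proof.
have mB : measurable (before_exit D w t%:E : set (measurableTypeR R)).
  exact: measurable_before_exit.
have mI : measurable (`[0, t[%classic : set (measurableTypeR R)).
  exact: measurable_itv.
move=> /(integrable_mkcond _ mB).1 iF; apply: (integrable_mkcond _ mI).2; move: iF.
have E := before_exit_restrict t%:E FE; rewrite set_lt_EFin in E.
by rewrite (restrict_EFin F) E -(restrict_EFin (killed psi w)).
Qed.

End integral_before_exit.

End exit_time_theory.

Lemma right_cont_measurable (R : realType) (k : R -> R) :
  (forall s, 0 <= s -> k u @[u --> s^'+] --> k s) -> measurable_fun (`[0, +oo[%classic : set R) k.
Proof.
move=> ck; rewrite (itv_bndy_bigcup_BLeft_shift true 0 0).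
apply/measurable_fun_bigcup => i.
  exact: measurable_itv.
set t : R := 0 + (i + 0)%:R.
have mp : measurable_fun (setT `*` `[0, t[) (fun p : R * R => k p.2).
  apply: (@right_cont_measurable_prod _ R R (fun s _ => k s)).
    by move=> s _; exact: measurable_cst.
  by move=> _ s /andP[s0 _]; exact: ck.
have md : measurable_fun (`[0, t[%classic : set R) (fun s : R => (s, s)).
  by apply: measurable_funTS; exact: measurable_fun_pair.
apply: (measurable_comp _ _ mp md).
- by apply: measurableX => //; exact: measurable_itv.
- by move=> _ [s si <-].
Qed.

(** As [psi] is arbitrary outside [D], superlevel sets are computed by hand: before the exit they
    come from an open subset of [D], and after it the value 0 counts exactly when the level is
    negative. *)
Lemma killed_past_measurable (R : realType) (S : topologicalType) (D : set S)
    (B : Defs.basis R) (X : R -> B -> S) (psi : S -> R) (t : R) :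
  open D -> (forall y, D y -> {for y, continuous psi}) ->
  adapted X -> stopping_time (fun w => exit_time D (X ^~ w)) -> 0 <= t ->
  measurable_fun (setT : set (past B t)) (fun w => killed D psi (X ^~ w) t).
Proof.
move=> oD cpsi aX sX t0.
apply: (measurability (@RGenOInfty.G R) (@RGenOInfty.measurableE R)).
move=> _ [_ [x ->] <-]; rewrite setTI.
pose E : set (past B t) := [set w | (exit_time D (X ^~ w) <= t%:E)%E].
have mE : measurable E by rewrite measurable_pastE//; exact: sX.
pose U : set S := [set y | D y /\ x < psi y].
have oU : open U.
  rewrite openE => y [Dy xy]; apply: filterI; first exact: open_nbhs_nbhs.
  by have := cpsi y Dy; move=> /cvgr_gt; apply.
pose G : set (past B t) := X t @^-1` U.
have mG : measurable G.
  by rewrite measurable_pastE//; apply: aX => //; exact: sub_gen_smallest.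
have -> : (fun w => killed D psi (X ^~ w) t) @^-1` `]x, +oo[ =
    (G `&` ~` E) `|` (if x < 0 then E else set0).
  apply/seteqP; split => w /=; rewrite in_itv/= andbT /killed.
    case: ifPn => [te xp|te x0]; [left|right].
      split; last by apply/negP; rewrite -ltNge.
      by split => //; exact: before_exit_time te.
    by rewrite x0 /E /= leNgt.
  move=> [[[_ xp]]|]; first by move=> /negP; rewrite -ltNge => ->.
  by case: ifPn => // x0 Ew; rewrite ifN// -leNgt.
apply: measurableU; first by apply: measurableI => //; exact: measurableC.
by case: ifP.
Qed.

(** * Splitting the payoff of a path at a fixed time *)

Section payoff_theory.
Context {R : realType} {S : topologicalType} {A : metricType R}.
Variable Q : control_problem S A.
Variable pi : S -> A.
Hypothesis cpi : continuous pi.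
Local Notation D := (dom Q).

Let cost y := runc Q y (pi y).

Lemma policy_cost_continuous : continuous (fun y => runc Q y (pi y)).
Proof.
move=> y; have cf := @runc_continuous _ _ _ Q (y, pi y).
have cp : (z, pi z) @[z --> y] --> (y, pi y).
  by apply: cvg_pair => //=; exact: cpi.
exact: cvg_comp cp cf.
Qed.

Let J (w : R -> S) := payoff Q w (pi \o w).

Let killed_cost_ge0 w s : 0 <= killed D cost w s.
Proof. by rewrite /killed; case: ifP => // _; exact: runc_ge0. Qed.

Lemma payoffE w : J w =
  (\int[@lebesgue_measure R]_(s in `[0%R, +oo[) (killed D cost w s)%:E + terminal_cost Q w)%E.
Proof.
rewrite /J /payoff /payoff_upto; congr (_ + _)%E.
by rewrite (@integral_before_exit _ _ _ cost w)// set_lt_pinfty.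
Qed.

Let mcost w : path_right_cont w -> measurable_fun (`[0, +oo[%classic : set R) (killed D cost w).
Proof.
move=> cw; apply: right_cont_measurable => s s0.
by apply: killed_right_cont => // y _; exact: policy_cost_continuous.
Qed.

Let mcostS w (E : set R) : path_right_cont w -> E `<=` `[0, +oo[ ->
  measurable_fun E (EFin \o killed D cost w).
Proof.
move=> cw E0; apply/measurable_EFinP; exact: measurable_funS (mcost cw).
Qed.

Lemma integral_killed_split w t : path_right_cont w -> 0 <= t ->
  (\int[@lebesgue_measure R]_(s in `[0%R, +oo[) (killed D cost w s)%:E =
   \int[@lebesgue_measure R]_(s in `[0%R, t[) (killed D cost w s)%:E +
   \int[@lebesgue_measure R]_(s in `[t, +oo[) (killed D cost w s)%:E)%E.
Proof.
move=> cw t0; rewrite -ge0_integral_setU//=.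
- by rewrite -itv_bndbnd_setU ?bnd_simp.
- by rewrite -itv_bndbnd_setU ?bnd_simp//; exact: mcostS.
- by move=> s _; rewrite lee_fin.
- apply/disj_setPS => s []/=; rewrite !in_itv/= andbT => /andP[_ st] /(lt_le_trans st).
  by rewrite ltxx.
Qed.

Lemma terminal_cost_future w t : path_right_cont w -> 0 <= t ->
  (t%:E < exit_time D w)%E -> terminal_cost Q (future D w t) = terminal_cost Q w.
Proof.
move=> cw t0 te; rewrite /terminal_cost exit_time_future//; last exact: dom_open.
case er : (exit_time D w) te => [r| |//] // te; rewrite -EFinB/=.
have tr : t <= r by rewrite -lee_fin ltW.
by rewrite /future max_r ?subr_ge0// addrC subrK (stopped_after er).
Qed.

(** Expressing the payoff of the future through the original path serves twice: to split the total
    payoff, and to show measurability in the sample point. *)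
Lemma payoff_future w t : path_right_cont w -> 0 <= t -> (t%:E < exit_time D w)%E ->
  J (future D w t) =
  (\int[@lebesgue_measure R]_(s in `[0%R, +oo[) (killed D cost w (t + s))%:E
   + terminal_cost Q w)%E.
Proof.
move=> cw t0 te; rewrite payoffE terminal_cost_future//; congr (_ + _)%E.
apply: eq_integral => s; rewrite inE/= in_itv/= andbT => s0; congr EFin.
rewrite /killed exit_time_future//; last exact: dom_open.
by rewrite lteBrDr// -EFinD [s + t]addrC; case: ifPn => // h; rewrite futureE.
Qed.

Lemma payoff_split w t : path_right_cont w -> 0 <= t -> (t%:E < exit_time D w)%E ->
  J w = (\int[@lebesgue_measure R]_(s in `[0%R, t[) (killed D cost w s)%:E +
         J (future D w t))%E.
Proof.
move=> cw t0 te; rewrite payoff_future// payoffE (integral_killed_split cw t0).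
rewrite -addeA; congr (_ + (_ + _))%E; apply: ge0_integral_translate.
- apply: mcostS => // s /=; rewrite !in_itv/= !andbT; exact: le_trans.
- by move=> s _; rewrite lee_fin.
Qed.

Lemma payoff_exited w t : path_right_cont w -> 0 <= t -> (exit_time D w <= t%:E)%E ->
  J w = (\int[@lebesgue_measure R]_(s in `[0%R, t[) (killed D cost w s)%:E +
         (termc Q (stopped D w t))%:E)%E.
Proof.
move=> cw t0 te; rewrite payoffE (integral_killed_split cw t0).
rewrite [X in (_ + X + _)%E]integral0_eq; last first.
  move=> s /=; rewrite in_itv/= andbT => ts; rewrite /killed ifN// -leNgt.
  by apply: le_trans te _; rewrite lee_fin.
rewrite adde0; congr (_ + _)%E; rewrite /terminal_cost.
have := exit_time_ge0 D w.
case er : (exit_time D w) te => [r| |//] // te _.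
by rewrite (stopped_after er).
Qed.

Lemma payoff_stopped w : path_right_cont w -> D (w 0) -> J (stopped D w) = J w.
Proof.
move=> cw D0; rewrite stopped_future [RHS](payoff_split cw (lexx 0)).
  by rewrite set_itv_ge ?integral_set0 ?add0e// bnd_simp ltxx.
rewrite lt_neqAle exit_time_ge0 andbT; apply/eqP => e0.
by apply: (exit_time_out (dom_open Q) cw (esym e0)).
Qed.

Lemma payoff_ge0 w : (0 <= J w)%E.
Proof.
rewrite payoffE adde_ge0//; first by apply: integral_ge0 => s _; rewrite lee_fin.
by rewrite /terminal_cost; case: exit_time => // r; rewrite lee_fin termc_ge0.
Qed.

End payoff_theory.

(** * The process controlled by a policy *)

Section policy_process_theory.
Context {R : realType} {S : topologicalType} {A : metricType R}.
Variable Q : control_problem S A.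
Variables (pi : S -> A) (x : S) (Y : @process R S).
Hypotheses (cpi : continuous pi) (Dx : dom Q x) (pY : policy_process Q pi x Y).
Local Notation D := (dom Q).
Local Notation B := (pbasis Y).
Local Notation P := (prob B).
Local Notation tau w := (exit_time D (Y ^~ w)).

Let cost y := runc Q y (pi y).
Definition total_payoff w := payoff Q (Y ^~ w) (pi \o (Y ^~ w)).
Definition cost_upto t w : \bar R :=
  (\int[@lebesgue_measure R]_(s in `[0%R, t[) (killed D cost (Y ^~ w) s)%:E)%E.

Lemma policy_adapted : adapted Y.
Proof. by case: pY => _ [[[]]]. Qed.

Lemma policy_right_cont w : path_right_cont (Y ^~ w).
Proof. by case: pY => _ [[[_ h] _ _ _ _] _] t t0; exact: h. Qed.

Lemma policy_start w : Y 0 w = x.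
Proof. by case: pY => _ [[_ h _ _ _] _]; exact: h. Qed.

Lemma policy_stopping : stopping_time (fun w => tau w).
Proof. by case: pY => _ [[_ _ h _ _] _]. Qed.

Lemma policy_dynkin phi : core Q phi ->
  dynkin_martingale D phi (fun s w => gen Q (pi (Y s w)) phi (Y s w)) Y.
Proof. by case: pY => _ [[_ _ _ h _] _]; exact: h. Qed.

Lemma total_payoff_integrable : P.-integrable setT total_payoff.
Proof. by case: pY => _ [[_ _ _ _ [_ []]] _]. Qed.

(** [cvg_L1] includes integrability of the truncated payoff at each time, and at time 0 only the
    terminal cost is left of it. This avoids discussing the state at the random time of exit. *)
Lemma terminal_cost_measurable :
  measurable_fun setT (fun w : B => terminal_cost Q (Y ^~ w)).
Proof.
case: pY => _ [[_ _ _ _ [_ [h _ _]]] _].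
have := measurable_int _ (h 0 (lexx 0)); apply: eq_measurable_fun => w _.
by rewrite /payoff_upto before_exit0 integral_set0 add0e.
Qed.

Lemma policy_exit_gt0 w : (0 < tau w)%E.
Proof.
rewrite lt_neqAle exit_time_ge0 andbT; apply/eqP => e0.
apply: (exit_time_out (dom_open Q) (@policy_right_cont w) (esym e0)).
by rewrite policy_start.
Qed.

Lemma policy_payoff_stopped w :
  payoff Q (stopped D (Y ^~ w)) (pi \o stopped D (Y ^~ w)) = total_payoff w.
Proof. by apply: payoff_stopped; [|exact: policy_right_cont|rewrite policy_start]. Qed.

Lemma killed_process_measurable psi t :
  (forall y, D y -> {for y, continuous psi}) -> 0 <= t ->
  measurable_fun (setT : set (past B t)) (fun w => killed D psi (Y ^~ w) t).
Proof.
move=> cpsi t0; apply: killed_past_measurable => //; first exact: dom_open.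
- exact: policy_adapted.
- exact: policy_stopping.
Qed.

Lemma killed_start psi w : killed D psi (Y ^~ w) 0 = psi x.
Proof. by rewrite /killed policy_exit_gt0 policy_start. Qed.

Let cost_cont y : D y -> {for y, continuous cost}.
Proof. by move=> _; exact: policy_cost_continuous. Qed.

Lemma cost_upto_measurable t : 0 <= t -> measurable_fun setT (cost_upto t).
Proof.
move=> t0; apply: right_cont_measurable_integral => [s /andP[s0 _]|w s /andP[s0 _]].
  exact: (past_measurable_fun s0 (killed_process_measurable cost_cont s0)).
by apply: killed_right_cont => //; exact: policy_right_cont.
Qed.

Lemma cost_upto_ge0 t w : (0 <= cost_upto t w)%E.
Proof.
apply: integral_ge0 => s _; rewrite lee_fin /killed; case: ifP => // _.
exact: runc_ge0.
Qed.

Definition alive t : set B := [set w | (t%:E < tau w)%E].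

Lemma alive_measurable t : 0 <= t -> measurable (alive t).
Proof.
move=> t0; rewrite (_ : alive t = ~` [set w | (tau w <= t%:E)%E]).
  apply: measurableC; apply: (@filt_sub R B t t0).
  exact: policy_stopping.
by apply/seteqP; split => w; rewrite /alive /= ltNge => /negP.
Qed.

Definition future_payoff t (w : B) := payoff Q (future D (Y ^~ w) t) (pi \o future D (Y ^~ w) t).

(* Not the difference of [total_payoff] and [cost_upto], which may both be infinite. *)
Lemma future_payoff_measurable t : 0 <= t -> measurable_fun (alive t) (future_payoff t).
Proof.
move=> t0.
apply: (eq_measurable_fun (fun w =>
  \int[@lebesgue_measure R]_(s in `[0%R, +oo[) (killed D cost (Y ^~ w) (t + s))%:E
  + terminal_cost Q (Y ^~ w))%E).
  move=> w /[!inE] aw; rewrite /future_payoff payoff_future//.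
  exact: policy_right_cont.
apply: measurable_funTS; apply: emeasurable_funD; last exact: terminal_cost_measurable.
apply: (@right_cont_measurable_integral_pinfty _ B R (fun s w => killed D cost (Y ^~ w) (t + s))).
  move=> s s0; have ts0 : 0 <= t + s by exact: addr_ge0.
  exact: (past_measurable_fun ts0 (killed_process_measurable cost_cont ts0)).
move=> w s s0; have ts0 : 0 <= t + s by exact: addr_ge0.
have h := @killed_right_cont R S D cost (Y ^~ w) cost_cont (@policy_right_cont w) _ ts0.
apply/cvg_at_rightP => u [su cu]; move/cvg_at_rightP: h => /(_ (fun n => t + u n)).
apply; split=> [n|]; first by rewrite ltrD2l.
by apply: cvgD => //; exact: cvg_cst.
Qed.

Lemma total_payoff_split t w : 0 <= t -> alive t w ->
  total_payoff w = (cost_upto t w + future_payoff t w)%E.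
Proof. by move=> t0 aw; apply: payoff_split => //; exact: policy_right_cont. Qed.

Lemma total_payoff_exited t w : 0 <= t -> ~ alive t w ->
  total_payoff w = (cost_upto t w + (termc Q (stopped D (Y ^~ w) t))%:E)%E.
Proof.
move=> t0 aw; apply: payoff_exited => //; first exact: policy_right_cont.
by rewrite leNgt; apply/negP.
Qed.

Lemma stopped_exited t w : 0 <= t -> ~ alive t w -> ~ D (stopped D (Y ^~ w) t).
Proof.
move=> t0 /negP; rewrite /alive /= -leNgt => te.
have := exit_time_ge0 D (Y ^~ w).
case er : (tau w) te => [r| |//] // te _.
rewrite (stopped_after er)//; apply: exit_time_out er; first exact: dom_open.
exact: policy_right_cont.
Qed.

Lemma terminal_cost_exited t w : 0 <= t -> ~ alive t w ->
  terminal_cost Q (Y ^~ w) = (termc Q (stopped D (Y ^~ w) t))%:E.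
Proof.
move=> t0 /negP; rewrite /alive /= -leNgt => te; rewrite /terminal_cost.
have := exit_time_ge0 D (Y ^~ w).
by case er : (tau w) te => [r| |//] // te _; rewrite (stopped_after er).
Qed.

End policy_process_theory.

(** * The Markov property of the value *)

Section value_theory.
Context {R : realType} {S : topologicalType} {A : metricType R}.
Variables (Q : control_problem S A) (Xpol : (S -> A) -> S -> @process R S).
Variable pi : S -> A.
Hypothesis cpi : continuous pi.
Local Notation D := (dom Q).
Hypothesis pX : forall x, D x -> policy_process Q pi x (Xpol pi x).
Hypothesis markovX : markov_until_exit D (Xpol pi).

Let V := value Q Xpol pi.

Lemma value_exit x : ~ D x -> V x = termc Q x.
Proof. by move=> nDx; rewrite /V /value memNset. Qed.

Lemma valueE x : D x -> (V x)%:E = (\int[prob (pbasis (Xpol pi x))]_w total_payoff Q pi w)%E.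
Proof.
move=> Dx; rewrite /V /value mem_set// fineK//.
by apply: integrable_fin_num => //; exact: (total_payoff_integrable (pX Dx)).
Qed.

Lemma value_ge0 x : 0 <= V x.
Proof.
have [Dx|nDx] := pselect (D x); last by rewrite value_exit// termc_ge0.
by rewrite -lee_fin valueE//; apply: integral_ge0 => w _; exact: payoff_ge0.
Qed.

Section fixed_start.
Variables (x : S) (Dx : D x).
Let Y := Xpol pi x.
Local Notation B := (pbasis Y).
Local Notation P := (prob B).

Let Vst t (w : B) : \bar R := (V (stopped D (Y ^~ w) t))%:E.

(** The Markov property for the payoff functional: its right-hand side is the value at the current
    state, since stopping a path at its exit does not change its payoff. *)
Lemma markov_value t : 0 <= t ->
  measurable_fun (alive Q t) (Vst t) /\
  forall G, filt t G -> (\int[P]_(w in G `&` alive Q t) future_payoff Q pi t w =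
                         \int[P]_(w in G `&` alive Q t) Vst t w)%E.
Proof.
move=> t0.
pose Phi (w : R -> S) := payoff Q w (pi \o w).
have Phi0 w : (0 <= Phi w)%E by exact: payoff_ge0.
have PhiE y : D y -> (fun w => Phi (stopped D (Xpol pi y ^~ w))) = total_payoff Q pi (Y := Xpol pi y).
  by move=> Dy; apply/funext => w; exact: (policy_payoff_stopped cpi Dy (pX Dy)).
have Phii y : D y -> (plaw (Xpol pi y)).-integrable setT (fun w => Phi (stopped D (Xpol pi y ^~ w))).
  by move=> Dy; rewrite PhiE//; exact: (total_payoff_integrable (pX Dy)).
have := markovX Dx t0 Phi0 Phii.
rewrite /= => /(_ (future_payoff_measurable cpi (pX Dx) t0))[mrhs E].
have rhsE w : alive Q t w -> (\int[plaw (Xpol pi (Xpol pi x t w))]_v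
   Phi (stopped D (Xpol pi (Xpol pi x t w) ^~ v)))%E = Vst t w.
  move=> aw; have Dw := before_exit_time t0 aw.
  by rewrite /Vst (stopped_before t0 aw) valueE// -PhiE.
split.
  by apply: eq_measurable_fun mrhs => w /[!inE] aw; exact: rhsE.
move=> G FG; rewrite [LHS]E.
  by apply: eq_integral => w /[!inE] -[_ aw]; exact: rhsE.
(* For the constant time [t], the trace of [G] at time [u] is [G] if [t <= u] and empty
   otherwise. *)
split; first exact: (@filt_sub R B t t0).
move=> u u0; have [tu|ut] := leP t u.
  rewrite (_ : mkset _ = setT) ?setIT; last by apply/seteqP; split => // w _; rewrite /= lee_fin.
  exact: (@filt_mono R B t u t0 tu).
rewrite (_ : mkset _ = set0) ?setI0.
  by have [] := @filt_sigma R B u u0.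
by apply/seteqP; split => // w /=; rewrite lee_fin leNgt ut.
Qed.

(** [V] is not known to be Borel here. Before the exit the Markov property supplies measurability;
    afterwards the value is the terminal cost. *)
Lemma stopped_value_measurable t : 0 <= t -> measurable_fun setT (Vst t).
Proof.
move=> t0; have mA := alive_measurable (pX Dx) t0.
rewrite -(setUv (alive Q t)); apply/measurable_funU => //; first exact: measurableC.
split; first exact: (markov_value t0).1.
apply: (eq_measurable_fun (fun w => terminal_cost Q (Y ^~ w))).
  move=> w /[!inE] nw; rewrite (terminal_cost_exited t0 nw) /Vst value_exit//.
  exact: (stopped_exited (pX Dx) t0 nw).
by apply: measurable_funTS; exact: (terminal_cost_measurable (pX Dx)).
Qed.

Let Vst_ge0 t w : (0 <= Vst t w)%E.
Proof. by rewrite lee_fin value_ge0. Qed.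

Lemma value_plus_cost t G : 0 <= t -> filt t G ->
  (\int[P]_(w in G) total_payoff Q pi w =
   \int[P]_(w in G) (cost_upto Q pi t w + Vst t w))%E.
Proof.
move=> t0 FG; have mA := alive_measurable (pX Dx) t0.
have mG : measurable G by exact: (@filt_sub R B t t0).
have mC := cost_upto_measurable cpi (pX Dx) t0.
have mV := stopped_value_measurable t0.
have mF := future_payoff_measurable cpi (pX Dx) t0.
have mJ : measurable_fun setT (total_payoff Q pi (Y := Y)).
  exact: measurable_int (total_payoff_integrable (pX Dx)).
have C0 (w : B) : (0 <= cost_upto Q pi t w)%E by exact: cost_upto_ge0.
have mGA : measurable (G `&` alive Q t) by exact: measurableI.
have mGD : measurable (G `\` alive Q t) by exact: measurableD.
have GE : G = (G `&` alive Q t) `|` (G `\` alive Q t).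
  by rewrite -setIUr setUv setIT.
have dG : [disjoint G `&` alive Q t & G `\` alive Q t].
  by apply/disj_setPS => w [[_ aw] [_ /(_ aw)]].
rewrite [in LHS]GE [in RHS]GE !ge0_integral_setU//.
- congr (_ + _)%E; last first.
    apply: eq_integral => w /[!inE] -[_ nw]; rewrite (total_payoff_exited cpi (pX Dx) t0 nw).
    congr (_ + _)%E; rewrite /Vst value_exit//.
    exact: (stopped_exited (pX Dx) t0 nw).
  transitivity (\int[P]_(w in G `&` alive Q t) (cost_upto Q pi t w + future_payoff Q pi t w))%E.
    by apply: eq_integral => w /[!inE] -[_ aw]; rewrite (total_payoff_split cpi (pX Dx) t0 aw).
  have mCA : measurable_fun (G `&` alive Q t) (cost_upto Q pi t (Y := Y)).
    exact: measurable_funTS.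
  have mFA : measurable_fun (G `&` alive Q t) (future_payoff Q pi t (Y := Y)).
    by apply: measurable_funS mF.
  have mVA : measurable_fun (G `&` alive Q t) (Vst t) by exact: measurable_funTS.
  rewrite (ge0_integralD P mGA (fun w _ => C0 w) mCA _ mFA); last first.
    by move=> w _; exact: payoff_ge0.
  by rewrite (ge0_integralD P mGA (fun w _ => C0 w) mCA _ mVA)// (markov_value t0).2.
- by apply: measurable_funTS; apply: emeasurable_funD.
- by move=> w _; rewrite adde_ge0.
- exact: measurable_funTS.
- by move=> w _; exact: payoff_ge0.
Qed.

Lemma value_plus_cost_integrable t : 0 <= t ->
  P.-integrable setT (cost_upto Q pi t (Y := Y)) /\ P.-integrable setT (Vst t).
Proof.
move=> t0; have mC := cost_upto_measurable cpi (pX Dx) t0.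
have mV := stopped_value_measurable t0.
have C0 (w : B) : (0 <= cost_upto Q pi t w)%E by exact: cost_upto_ge0.
have fin : (\int[P]_w (cost_upto Q pi t w + Vst t w) < +oo)%E.
  rewrite -value_plus_cost//; last exact: filtT.
  have /integrableP[_] := total_payoff_integrable (pX Dx).
  by under eq_integral do rewrite gee0_abs ?payoff_ge0//.
by split; apply/integrableP; split => //; apply: le_lt_trans fin;
  apply: ge0_le_integral => //; (try by apply: emeasurable_funD);
  (try exact: measurableT_comp);
  move=> w _; rewrite ?adde_ge0// gee0_abs// ?leeDl ?leeDr.
Qed.

End fixed_start.
End value_theory.

(** * Generators and Dynkin martingales along a policy *)

Lemma gen_continuous_at (R : realType) (S : topologicalType) (A : metricType R)
    (Q : control_problem S A) (phi : S -> R) : core Q phi ->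
  forall y, dom Q y -> forall a,
  {for (y, a), continuous (fun p : S * A => gen Q p.2 phi p.1)}.
Proof.
move=> cphi y Dy a; have := gen_continuous cphi.
rewrite continuous_open_subspace; first by apply; rewrite inE.
rewrite openE => -[z b] [Dz _]; exists (dom Q, setT) => //=.
by split; [exact: open_nbhs_nbhs (conj (dom_open Q) Dz)|exact: filterT].
Qed.

Lemma gen_policy_continuous (R : realType) (S : topologicalType) (A : metricType R)
    (Q : control_problem S A) (pi : S -> A) (phi : S -> R) :
  continuous pi -> core Q phi ->
  forall y, dom Q y -> {for y, continuous (fun z => gen Q (pi z) phi z)}.
Proof.
move=> cpi cphi y Dy.
have cp : (z, pi z) @[z --> y] --> (y, pi y).
  by apply: cvg_pair => //=; exact: cpi.
have cg := @gen_continuous_at _ _ _ _ _ cphi _ Dy (pi y).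
exact: cvg_comp cp cg.
Qed.

Section dynkin_process.
Context {R : realType} {S : topologicalType} {A : metricType R}.
Variables (Q : control_problem S A) (pi : S -> A) (x : S) (Y : @process R S).
Hypotheses (cpi : continuous pi) (Dx : dom Q x) (pY : policy_process Q pi x Y).
Variable phi : S -> R.
Hypothesis cphi : core Q phi.
Local Notation D := (dom Q).
Local Notation B := (pbasis Y).
Local Notation P := (prob B).
Hypothesis icost : forall t, 0 <= t -> P.-integrable setT (cost_upto Q pi t (Y := Y)).

Let cost y := runc Q y (pi y).
Definition drift y := gen Q (pi y) phi y + runc Q y (pi y).

Definition compensated t (w : B) : R := phi (stopped D (Y ^~ w) t) -
  \int[@lebesgue_measure R]_(s in before_exit D (Y ^~ w) t%:E) gen Q (pi (Y s w)) phi (Y s w).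

Lemma drift_continuous y : D y -> {for y, continuous drift}.
Proof.
move=> Dy; apply: cvgD; first exact: gen_policy_continuous.
exact: policy_cost_continuous.
Qed.

Lemma compensated_integrable t : 0 <= t -> P.-integrable setT (fun w => (compensated t w)%:E).
Proof. by case: (policy_dynkin pY cphi) => _ [_ h _]; exact: h. Qed.

Lemma compensated_martingale s t G : 0 <= s -> s <= t -> filt s G ->
  (\int[P]_(w in G) (compensated t w)%:E = \int[P]_(w in G) (compensated s w)%:E)%E.
Proof. by case: (policy_dynkin pY cphi) => _ [_ _ h] s0 st FG; exact: h. Qed.

Lemma compensated0 w : compensated 0 w = phi x.
Proof.
by rewrite /compensated stopped0 (policy_start pY) before_exit0 Rintegral_set0 subr0.
Qed.

(** The integral of the sum may be split only where both summands are integrable: the generator term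
    is so by the Dynkin property, the cost because its expectation is finite. Each holds only almost
    surely. *)
Lemma drift_ae t : 0 <= t -> {ae P, forall w,
  (@lebesgue_measure R).-integrable `[0, t[ (fun s => (killed D drift (Y ^~ w) s)%:E) /\
  (\int[@lebesgue_measure R]_(s in `[0%R, t[) (killed D drift (Y ^~ w) s)%:E =
   cost_upto Q pi t w + (phi (stopped D (Y ^~ w) t))%:E - (compensated t w)%:E)%E}.
Proof.
move=> t0; case: (policy_dynkin pY cphi) => iL _.
have := integrable_ae measurableT (icost t0); move: iL; apply: filterS2 => w iL /(_ I) fC.
pose psi y := gen Q (pi y) phi y.
have ipsi : (@lebesgue_measure R).-integrable `[0, t[ (fun s => (killed D psi (Y ^~ w) s)%:E).
  by apply: integrable_before_exit (iL t t0).
have mI : measurable (`[0, t[%classic : set (measurableTypeR R)).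
  exact: measurable_itv.
have icst : (@lebesgue_measure R).-integrable `[0, t[ (fun s => (killed D cost (Y ^~ w) s)%:E).
  apply/integrableP; split.
    apply/measurable_EFinP.
    have mk : measurable_fun (`[0, +oo[%classic : set R) (killed D cost (Y ^~ w)).
      apply: right_cont_measurable => s s0; apply: killed_right_cont => //.
        by move=> y _; exact: policy_cost_continuous.
      exact: (@policy_right_cont _ _ _ _ _ _ _ pY w).
    have sub : `[0, t[ `<=` (`[0, +oo[%classic : set R).
      by apply: subset_itvl; rewrite bnd_simp.
    exact: measurable_funS sub mk.
  have kc0 s : 0 <= killed D cost (Y ^~ w) s.
    by rewrite /killed; case: ifP => // _; exact: runc_ge0.
  under eq_integral do rewrite gee0_abs ?lee_fin//.
  by rewrite -ge0_fin_numE// cost_upto_ge0.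
have kE s : killed D drift (Y ^~ w) s = killed D psi (Y ^~ w) s + killed D cost (Y ^~ w) s.
  by rewrite /killed; case: ifP; rewrite ?addr0.
under eq_integral do rewrite kE EFinD.
under [X in integrable _ _ X]eq_fun do rewrite kE EFinD.
split; first exact: integrableD.
rewrite integralD//.
rewrite -[X in (_ + X)%E = _]/(cost_upto Q pi t w) [LHS]addeC -[RHS]addeA.
congr (cost_upto Q pi t w + _)%E.
rewrite /compensated -EFinB opprB addrC subrK.
rewrite (@Rintegral_before_exit _ _ _ psi (Y ^~ w))// set_lt_EFin.
by rewrite /Rintegral fineK// integrable_fin_num.
Qed.

End dynkin_process.

(** * The sign of the drift and its consequence for the value *)

Lemma ae_le_integral d (T : measurableType d) (R : realType)
    (mu : {measure set T -> \bar R}) (f g : T -> \bar R) :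
  mu.-integrable setT f -> mu.-integrable setT g ->
  {ae mu, forall x, (f x <= g x)%E} -> (\int[mu]_x f x <= \int[mu]_x g x)%E.
Proof.
move=> iF iG fg; have igf := integrableB measurableT iG iF.
rewrite -sube_ge0 ?integrable_fin_num// -integralB// integralE.
rewrite [X in (_ - X)%E](@ae_eq_integral _ _ _ mu setT (cst 0%E))//.
- by rewrite integral0 sube0; apply: integral_ge0 => x _; exact: funepos_ge0.
- exact: measurable_funeneg (measurable_int _ igf).
- have := integrable_ae measurableT iF; move: fg; apply: filterS2 => x fgx /(_ I) ff _.
  apply: (@ge0_funenegE _ _ [set x]); last by rewrite inE.
  by move=> _ ->; rewrite sube_ge0// ff.
Qed.

Section value_drift.
Context {R : realType} {S : topologicalType} {A : metricType R}.
Variables (Q : control_problem S A) (Xpol : (S -> A) -> S -> @process R S).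
Variable pi : S -> A.
Hypothesis cpi : continuous pi.
Local Notation D := (dom Q).
Hypothesis pX : forall x, D x -> policy_process Q pi x (Xpol pi x).
Hypothesis markovX : markov_until_exit D (Xpol pi).
Let V := value Q Xpol pi.
Variables (x : S) (Dx : D x).
Let Y := Xpol pi x.
Local Notation B := (pbasis Y).
Local Notation P := (prob B).

Let iC t : 0 <= t -> P.-integrable setT (cost_upto Q pi t (Y := Y)).
Proof. by move=> t0; case: (value_plus_cost_integrable cpi pX markovX Dx t0). Qed.

Let iV t : 0 <= t -> P.-integrable setT (fun w => (V (stopped D (Y ^~ w) t))%:E).
Proof. by move=> t0; case: (value_plus_cost_integrable cpi pX markovX Dx t0). Qed.

Lemma value_drift_ge0 : core Q V -> 0 <= drift Q pi V x.
Proof.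
move=> cV.
have dae := drift_ae cpi (pX Dx) cV iC.
pose M t (w : B) : \bar R := (compensated Q pi V t w)%:E.
have iM t : 0 <= t -> P.-integrable setT (M t) by exact: (compensated_integrable (pX Dx) cV).
pose U t (w : B) : \bar R := (cost_upto Q pi t w + (V (stopped D (Y ^~ w) t))%:E)%E.
have iU t : 0 <= t -> P.-integrable setT (U t).
  by move=> t0; apply: integrableD => //; [exact: iC|exact: iV].
have iUM t : 0 <= t -> P.-integrable setT (fun w => U t w - M t w)%E.
  by move=> t0; apply: integrableB => //; [exact: iU|exact: iM].
have mk t : 0 <= t -> measurable_fun (setT : set (past B t))
    (fun w => killed D (drift Q pi V) (Y ^~ w) t).
  move=> t0; apply: (killed_process_measurable (pX Dx)) => //.
  by move=> y Dy; exact: drift_continuous.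
have ck (w : B) s : 0 <= s ->
    killed D (drift Q pi V) (Y ^~ w) u @[u --> s^'+] --> killed D (drift Q pi V) (Y ^~ w) s.
  apply: killed_right_cont; first by move=> y Dy; exact: drift_continuous.
  exact: (@policy_right_cont _ _ _ _ _ _ _ (pX Dx) w).
pose N t (w : B) : \bar R :=
  (\int[@lebesgue_measure R]_(s in `[0%R, t[) (killed D (drift Q pi V) (Y ^~ w) s)%:E)%E.
have mN t : 0 <= t -> measurable_fun setT (N t).
  move=> t0; apply: right_cont_measurable_integral => [s /andP[s0 _]|w s /andP[s0 _]].
    exact: (past_measurable_fun s0 (mk s s0)).
  exact: ck.
have NUM t : 0 <= t -> ae_eq P setT (N t) (fun w => U t w - M t w)%E.
  by move=> t0; have := dae t t0; apply: filterS => w [_ E] _; exact: E.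
apply: (finite_variation_martingale_ge0 mk ck).
(* Any time beyond 1 would do: [drift_ae] covers [0, t[, and the closed interval [0, 1] is
   required. *)
- have := dae 2 (ler0n _ _); apply: filterS => w [iw _].
  apply: integrableS iw; [exact: measurable_itv|exact: measurable_itv|].
  by apply: subset_itvl; rewrite bnd_simp ltr1n.
- move=> t t0; apply/integrableP; split; first exact: mN.
  have /integrableP[mUM] := iUM t t0; apply: le_lt_trans.
  rewrite (@ae_eq_integral _ _ _ P setT (fun w => `|U t w - M t w|)%E)//.
  + by apply: measurableT_comp => //; exact: mN.
  + exact: measurableT_comp.
  + by have := NUM t t0; apply: filterS => w h _; congr (`|_|)%E; exact: h.
(* The total payoff does not depend on [t], so on events of the past the only varying term is the
   Dynkin martingale. *)
- have GE t G : 0 <= t -> filt t G ->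
      (\int[P]_(w in G) N t w = \int[P]_(w in G) total_payoff Q pi w - \int[P]_(w in G) M t w)%E.
    move=> t0 FG; have mG : measurable G by exact: (@filt_sub R B t t0).
    rewrite (value_plus_cost cpi pX markovX Dx t0 FG).
    have iUG : P.-integrable G (U t) by apply: integrableS (iU t t0).
    have iMG : P.-integrable G (M t) by apply: integrableS (iM t t0).
    have := integralB mG iUG iMG => /= <-.
    apply: ae_eq_integral => //.
    + by apply: measurable_funTS; exact: mN.
    + by apply: measurable_funTS; exact: measurable_int (iUM t t0).
    + by have := NUM t t0; apply: filterS => w h _; exact: h.
  move=> s t s0 st G FG; have t0 := le_trans s0 st.
  have Gt : filt t G by exact: (@filt_mono R B s t s0 st).
  apply: (eq_trans (GE t G t0 Gt)); apply: (eq_trans _ (esym (GE s G s0 FG))).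
  by rewrite /M (compensated_martingale (pX Dx) cV s0 st FG).
- by move=> w; exact: (killed_start Dx (pX Dx)).
Qed.

(** [V x] is the expectation of cost plus [V] at time [t], and [phi x] that of the compensated
    process. Their difference is [V - phi] at time [t] plus the integral of the drift. Here [phi]
    need not be the value of [pi]: it will be that of the previous policy. *)
Lemma value_ge_compensated (phi : S -> R) (t : R) : core Q phi -> 0 <= t ->
  (forall y, D y -> 0 <= drift Q pi phi y) ->
  P.-integrable setT (fun w => (V (stopped D (Y ^~ w) t) - phi (stopped D (Y ^~ w) t))%:E) ->
  ((phi x)%:E + \int[P]_w (V (stopped D (Y ^~ w) t) - phi (stopped D (Y ^~ w) t))%:E
   <= (V x)%:E)%E.
Proof.
move=> cphi t0 dge iW.
have iM := compensated_integrable (pX Dx) cphi t0.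
have M0 : (\int[P]_w (compensated Q pi phi t w)%:E = (phi x)%:E)%E.
  rewrite (compensated_martingale (pX Dx) cphi (lexx 0) t0 (filtT B (lexx 0))).
  under eq_integral do rewrite (compensated0 (pX Dx)).
  by rewrite integral_cst// [X in (_ * X)%E](probability_setT P) mule1.
rewrite -M0 (valueE pX Dx) (value_plus_cost cpi pX markovX Dx t0 (filtT B t0)).
have iCV : P.-integrable setT (fun w => cost_upto Q pi t w + (V (stopped D (Y ^~ w) t))%:E)%E.
  by apply: integrableD => //; [exact: iC|exact: iV].
have iMW : P.-integrable setT (fun w => (compensated Q pi phi t w)%:E +
    (V (stopped D (Y ^~ w) t) - phi (stopped D (Y ^~ w) t))%:E)%E.
  exact: integrableD.
have := integralD measurableT iM iW => /= <-.
apply: (ae_le_integral iMW iCV).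
have := drift_ae cpi (pX Dx) cphi iC t0.
have := integrable_ae measurableT (iC t0); apply: filterS2 => w /(_ I) fC [_ E].
have : (0 <= \int[@lebesgue_measure R]_(s in `[0%R, t[) (killed D (drift Q pi phi) (Y ^~ w) s)%:E)%E.
  apply: integral_ge0 => s; rewrite /= in_itv/= => /andP[s0 _]; rewrite lee_fin /killed.
  by case: ifPn => // se; apply: dge; exact: before_exit_time se.
rewrite E -(fineK fC); move: (fine _) (phi _) (V _) (compensated _ _ _ _ _) => c p v m.
by rewrite -!EFinD -?EFinN -?EFinD !lee_fin; lra.
Qed.

End value_drift.

(** * Comparison of consecutive policies *)

(** A real [sup] dominates the members of a set only if the set is bounded above; compactness of the
    action space guarantees this. *)
Lemma hamiltonian_has_ubound (R : realType) (S : topologicalType) (A : metricType R)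
    (Q : control_problem S A) (phi : S -> R) (y : S) :
  core Q phi -> dom Q y ->
  has_ubound (range (fun a => gen Q a phi y + runc Q y a)).
Proof.
move=> cphi Dy.
have cf : continuous (fun a => gen Q a phi y + runc Q y a).
  move=> a; have cp : (y, b) @[b --> a] --> (y, a).
    by apply: cvg_pair => //=; exact: cvg_cst.
  apply: cvgD.
    have cg := @gen_continuous_at _ _ _ _ _ cphi _ Dy a; exact: cvg_comp cp cg.
  have cr := @runc_continuous _ _ _ Q (y, a); exact: cvg_comp cp cr.
have : compact (range (fun a => gen Q a phi y + runc Q y a)).
  by apply: continuous_compact (action_compact Q); exact: continuous_subspaceT.
move=> /compact_bounded [M [_ /(_ (M + 1))]] /= bM.
exists (M + 1) => _ [a _ <-]; apply: le_trans (ler_norm _) _.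
by apply: bM; [rewrite ltrDl|exists a].
Qed.

(** At a time where the L1 distance is below [e], the expectation of [Z] is at most that of [Y t]
    plus [e], hence at most [c + e]. *)
Lemma expectation_cvg_L1_ge0 (R : realType) (B : Defs.basis R) (Y : R -> B -> R)
    (Z : B -> R) (c : R) :
  cvg_L1 (fun t w => (Y t w)%:E) (fun w => (Z w)%:E) ->
  {ae prob B, forall w, 0 <= Z w} ->
  (forall t, 0 <= t -> (\int[prob B]_w (Y t w)%:E <= c%:E)%E) -> 0 <= c.
Proof.
move=> [iY iZ cv] Z0 Yc; apply/ler_addgt0Pr => e e0.
have [t [t0 te]] : exists t, 0 <= t /\ (\int[prob B]_w `|(Y t w)%:E - (Z w)%:E| < e%:E)%E.
  have : \forall t \near +oo%R, (\int[prob B]_w `|(Y t w)%:E - (Z w)%:E| < e%:E)%E.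
    have : nbhs (0%E : \bar R) [set y | (y < e%:E)%E].
      by apply: open_nbhs_nbhs; split; [exact: open_ereal_lt_ereal|rewrite /= lte_fin].
    exact: cv.
  move=> [M [_ HM]]; exists (Num.max M 0 + 1).
  have M0 : 0 <= Num.max M 0 by rewrite le_max lexx orbT.
  split; first by rewrite addr_ge0.
  by apply: HM; rewrite ltr_pwDr// le_max lexx.
have iD : (prob B).-integrable setT (fun w => `|(Y t w)%:E - (Z w)%:E|%E).
  by apply: integrable_abse; apply: integrableB => //; exact: iY.
rewrite -lee_fin EFinD; apply: (@le_trans _ _ (\int[prob B]_w (Z w)%:E)%E).
  rewrite -[leLHS](integral0 (prob B) setT); apply: ae_le_integral => //.
    exact: integrable0.
apply: (@le_trans _ _ (\int[prob B]_w ((Y t w)%:E + `|(Y t w)%:E - (Z w)%:E|))%E).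
  apply: le_integral => //; first exact: integrableD (iY t t0) iD.
  move=> w _; rewrite -EFinB -EFinD lee_fin -lerBlDl.
  by rewrite distrC ler_norm.
have := integralD measurableT (iY t t0) iD => /= ->.
by apply: leeD; [exact: Yc|exact: ltW].
Qed.

Theorem theorem1 (R : realType) (S : topologicalType) (A : metricType R)
    (Q : control_problem S A)
    (Xpol : (S -> A) -> S -> @process R S)
    (hXpol : forall pi, markov_policy Q pi ->
       forall x, dom Q x -> policy_process Q pi x (Xpol pi x))
    (pia : (S -> A) -> nat -> S -> A)
    (Istar : set (S -> A))
    (Istar_nonempty : Istar !=set0)
    (Istar_improvable : forall pi, Istar pi -> improvable Q Xpol pi)
    (Istar_markov : forall pi, Istar pi -> markov_until_exit (dom Q) (Xpol pi))
    (hpia : forall pi0, Istar pi0 -> pia_run Q Xpol pi0 (pia pi0))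
    (assumption1 : forall pi0, Istar pi0 -> forall n,
       continuous (pia pi0 n) /\ Istar (pia pi0 n))
    (assumption2 : forall pi0, Istar pi0 -> forall n x, dom Q x ->
       let X := Xpol (pia pi0 n.+1) x in
       exists Z : pbasis X -> R,
         [/\ measurable_fun setT Z,
             {ae plaw X, forall w, 0 <= Z w} &
             cvg_L1
               (fun t w =>
                  (value Q Xpol (pia pi0 n.+1) (stopped (dom Q) (X ^~ w) t) -
                   value Q Xpol (pia pi0 n) (stopped (dom Q) (X ^~ w) t))%:E)
               (fun w => (Z w)%:E)])
    (pi0 : S -> A) (hpi0 : Istar pi0) :
  forall (n : nat) (x : S),
    value Q Xpol (pia pi0 n) x <= value Q Xpol (pia pi0 n.+1) x.
Proof.
have [_ run] := hpia _ hpi0.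
have cont n := (assumption1 _ hpi0 n).1.
have star n := (assumption1 _ hpi0 n).2.
have mpol n : markov_policy Q (pia pi0 n) by case: (Istar_improvable _ (star n)).
have cV n : core Q (value Q Xpol (pia pi0 n)) by case: (Istar_improvable _ (star n)).
have pX n := hXpol _ (mpol n).
have mX n := Istar_markov _ (star n).
have drift0 n y : dom Q y -> 0 <= drift Q (pia pi0 n) (value Q Xpol (pia pi0 n)) y.
  by move=> Dy; exact: (value_drift_ge0 (cont n) (pX n) (mX n) Dy (cV n)).
have drift1 n y : dom Q y -> 0 <= drift Q (pia pi0 n.+1) (value Q Xpol (pia pi0 n)) y.
  move=> Dy; apply: le_trans (drift0 n y Dy) _.
  have [_ [_ imp]] := run n; rewrite [leRHS]/drift (imp y Dy).
  apply: ub_le_sup; first exact: hamiltonian_has_ubound (cV n) Dy.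
  by exists (pia pi0 n y).
move=> n x; have [Dx|nDx] := pselect (dom Q x); last by rewrite !value_exit.
have [Z [mZ Z0 cvZ]] := assumption2 _ hpi0 n x Dx.
rewrite -subr_ge0; apply: (expectation_cvg_L1_ge0 cvZ Z0) => t t0.
(* The Markov property yields integrability only for a policy's own value along its own process; for
   the difference it is part of [cvg_L1]. *)
have iW := let: And3 h _ _ := cvZ in h t t0.
have := value_ge_compensated (cont n.+1) (pX n.+1) (mX n.+1) Dx (cV n) t0 (drift1 n) iW.
by rewrite EFinB leeBrDl.
Qed.
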